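(* Let $(\mathbb{N},d)$ and $(\mathbb{N},\partial)$ be uniformly locally finite metric spaces, and let $E$ and $F$ be Banach spaces with a $d$-symmetric basis $\mathcal{E}$ and a $\partial$-symmetric basis $\mathcal{F}$, respectively. Assume that all ghost idempotents in $\mathrm{B}_u(d,\mathcal{E})$ and in $\mathrm{B}_u(\partial,\mathcal{F})$ are compact. If $\mathrm{B}_u(d,\mathcal{E})$ and $\mathrm{B}_u(\partial,\mathcal{F})$ are Banach algebra isomorphic, then $(\mathbb{N},d)$ and $(\mathbb{N},\partial)$ are coarsely equivalent.
   Context: All Banach spaces are complex, and ''basis'' means Schauder basis. For a basis $\mathcal{E}=(e_n)_n$ of $E$, $(e_n^* )_n$ denotes the biorthogonal functionals and $\mathcal{L}(E)$ the bounded operators on $E$. Given a metric $d$ on $\mathbb{N}$, $a\in\mathcal{L}(E)$ is a band operator (with respect to $\mathcal{E}$ and $d$) if there is $r>0$ such that $e_m^*(ae_n)=0$ whenever $d(n,m)>r$. $\mathrm{B}_u[d,\mathcal{E}]$ is the algebra of band operators, and the uniform Roe algebra $\mathrm{B}_u(d,\mathcal{E})$ is its operator-norm closure in $\mathcal{L}(E)$. A Banach algebra isomorphism is a bijective algebra homomorphism that is bounded with bounded inverse. A metric $d$ on $\mathbb{N}$ is uniformly locally finite if $\sup_{x}|B_r(x)|<\infty$ for all $r>0$ ($B_r(x)$ the closed $r$-ball). $\mathcal{E}$ is unconditional if there is $\lambda\ge1$ with $\|\sum_{n\le k}\alpha_ne_n\|\le\lambda\|\sum_{n\le k}\beta_ne_n\|$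 for all $k$ and all scalars with $|\alpha_n|\le|\beta_n|$. An unconditional basis $\mathcal{E}$ is $d$-symmetric if for all $r>0$ and all bijections $\sigma:A\to B$ between subsets $A,B\subset\mathbb{N}$ with $d(i,\sigma(i))\le r$ for all $i\in A$, there is $C>0$ such that $C^{-1}\|\sum\alpha_ne_n\|\le\|\sum\alpha_ne_{\sigma(n)}\|\le C\|\sum\alpha_ne_n\|$ for all finitely supported scalar families $(\alpha_n)_{n\in A}$. An operator $a\in\mathcal{L}(E)$ is a ghost if for all $\varepsilon>0$ there is $n_0$ such that $|e_m^*(ae_n)|\le\varepsilon$ for all $n,m\ge n_0$; a ghost idempotent is a ghost $a$ with $a^2=a$. A map $f:(X,d)\to(Y,\partial)$ is coarse if for all $r>0$ there is $s>0$ such that $d(x,y)<r$ implies $\partial(f(x),f(y))<s$; expanding if for all $s>0$ there is $r>0$ such that $d(x,y)>r$ implies $\partial(f(x),f(y))>s$; a coarse embedding if it is both coarse and expanding; a coarse equivalence if moreover $\sup_{y\in Y}\partial(y,f(X))<\infty$. Two spaces are coarsely equivalent if there is a coarse equivalence between them. *)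

(* Defs.v *)
From HB Require Import structures.
From mathcomp Require Import all_boot all_order all_algebra.
From mathcomp Require Import complex.
From mathcomp Require Import all_classical all_reals all_analysis.

Set Implicit Arguments.
Unset Strict Implicit.
Unset Printing Implicit Defensive.

Import Order.TTheory GRing.Theory Num.Theory.
Import numFieldNormedType.Exports.

Local Open Scope classical_set_scope.
Local Open Scope ring_scope.
Local Open Scope complex_scope.

(* A complex Banach space is a [completeNormedModType R[i]] for a [realType] R.
   Its norm takes values in R[i], where [x <= y] forces [y - x] to be a
   nonnegative real; real bounds enter through the embedding [_%:C]. *)

Section Metrics.
Variable R : realType.
Implicit Types (d del : nat -> nat -> R) (f : nat -> nat).

Definition is_metric d :=
  [/\ forall x, d x x = 0,
      forall x y, d x y = 0 -> x = y,
      forall x y, d x y = d y x &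
      forall x y z, d x z <= d x y + d y z].

Definition unif_locally_finite d :=
  forall r : R, 0 < r ->
    exists N : nat, forall x, ([set y | (d x y <= r)%R] #<= `I_N)%card.

Definition coarse d del f :=
  forall r : R, 0 < r -> exists2 s : R, 0 < s &
    forall x y, d x y < r -> del (f x) (f y) < s.

Definition expanding d del f :=
  forall s : R, 0 < s -> exists2 r : R, 0 < r &
    forall x y, d x y > r -> del (f x) (f y) > s.

Definition coarse_embedding d del f := coarse d del f /\ expanding d del f.

Definition dist_to_set d (y : nat) (A : set nat) : R := inf [set d y z | z in A].

Definition coarse_equivalence d del f :=
  coarse_embedding d del f /\
  has_ubound [set dist_to_set del y (range f) | y in [set: nat]].

Definition coarsely_equivalent d del := exists f, coarse_equivalence d del f.

End Metrics.

Section Operators.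
Variable R : realType.

Definition bounded_operator (E F : normedModType R[i]) (a : E -> F) :=
  linear a /\ exists M : R, forall x, `|a x| <= M%:C * `|x|.

(* The supremum is meaningful only when [a] is a bounded operator. *)
Definition opnorm (E F : normedModType R[i]) (a : E -> F) : R :=
  sup [set complex.Re `|a x| | x in [set x : E | `|x| <= 1]].

Definition compact_operator (E F : normedModType R[i]) (a : E -> F) :=
  bounded_operator a /\ precompact (a @` [set x : E | `|x| <= 1]).

Definition idempotent_operator (E : Type) (a : E -> E) := a \o a = a.

(* [A] and [B] stand for subalgebras of L(E) and L(F); only the values of the
   isomorphism on [A] matter. *)
Definition banach_algebra_isomorphic (E F : normedModType R[i])
    (A : set (E -> E)) (B : set (F -> F)) :=
  exists Phi : (E -> E) -> (F -> F),
    [/\ set_bij A B Phi,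
        forall a b, A a -> A b -> Phi (a \+ b) = Phi a \+ Phi b,
        forall (c : R[i]) a, A a -> Phi (c \*: a) = c \*: Phi a,
        forall a b, A a -> A b -> Phi (a \o b) = Phi a \o Phi b &
        exists C : R, forall a, A a ->
          opnorm (Phi a) <= C * opnorm a /\ opnorm a <= C * opnorm (Phi a)].

End Operators.

Section Bases.
Variables (R : realType) (E : normedModType R[i]).
Implicit Types (d : nat -> nat -> R) (e : nat -> E) (a b : E -> E).

Definition expansion e (x : E) (c : nat -> R[i]) :=
  series (fun n => c n *: e n) @ \oo --> x.

Definition schauder_basis e := forall x, exists! c, expansion e x c.

(* The biorthogonal functional e_m^*: the m-th coefficient of the expansion of x
   (the default value 0 is irrelevant for a Schauder basis). *)
Definition biorth e (m : nat) (x : E) : R[i] :=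
  xget (fun=> 0) [set c | expansion e x c] m.

Definition unconditional e :=
  exists2 lam : R, 1 <= lam &
    forall (k : nat) (alpha beta : nat -> R[i]),
      (forall n, (n < k)%N -> `|alpha n| <= `|beta n|) ->
      `|\sum_(n < k) alpha n *: e n| <= lam%:C * `|\sum_(n < k) beta n *: e n|.

(* A finitely supported family indexed by A is a total function of which only
   the values on A are used. *)
Definition displacement_invariant d e :=
  forall (r : R) (A B : set nat) (sigma : nat -> nat),
    0 < r -> set_bij A B sigma -> (forall i, A i -> d i (sigma i) <= r) ->
    exists2 C : R, 0 < C &
      forall alpha : nat -> R[i], finite_set (A `&` [set n | alpha n != 0]) ->
        let s := \sum_(n \in A) alpha n *: e n in
        let s' := \sum_(n \in A) alpha n *: e (sigma n) in
        (C^-1)%:C * `|s| <= `|s'| /\ `|s'| <= C%:C * `|s|.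

Definition symmetric_basis d e :=
  [/\ schauder_basis e, unconditional e & displacement_invariant d e].

Definition band_operator d e a :=
  bounded_operator a /\
  exists2 r : R, 0 < r & forall n m, d n m > r -> biorth e m (a (e n)) = 0.

Definition uniform_roe_algebra d e : set (E -> E) :=
  [set a | bounded_operator a /\
    forall eps : R, 0 < eps ->
      exists2 b, band_operator d e b & opnorm (a \- b) < eps].

Definition ghost e a :=
  bounded_operator a /\
  forall eps : R, 0 < eps -> exists n0 : nat, forall n m,
    (n0 <= n)%N -> (n0 <= m)%N -> `|biorth e m (a (e n))| <= eps%:C.

Definition ghost_idempotents_compact d e :=
  forall a, uniform_roe_algebra d e a -> ghost e a -> idempotent_operator a ->
    compact_operator a.

End Bases.

(* Main.v *)
(* The isomorphism is spatial: it is conjugation by an invertible bounded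
   operator u : E -> F with inverse w.  Relate n and m when the scale-invariant
   sizes of e_n^*(w f_m) and of f_z^*(u e_n), for some z near m, are bounded
   below.  If some m were related to no n, then in sum_n P_n f_m = f_m, where
   P_A = u chi_A w is an idempotent of the Roe algebra for every set A of
   naturals, all coordinates of the terms near m would be tiny; a suitable
   choice of signs then gives an A with P_A f_m close to f_m / 2, which is impossible
   for an idempotent.  Only coordinates near m have to be controlled, because a
   gliding hump argument makes the approximation of the P_A by band operators
   uniform in A on the vectors f_m.  The same uniformity, applied to conjugated
   partial translations, shows that related pairs with close first components
   have close second components and conversely, so the relation contains the
   graph of a coarse equivalence. *)

Require Import Defs.
From mathcomp Require Import all_boot all_order all_algebra.
From mathcomp Require Import complex.
From mathcomp Require Import all_classical all_reals all_analysis.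
From mathcomp Require Import ring lra.

Set Implicit Arguments.
Unset Strict Implicit.
Unset Printing Implicit Defensive.

Import Order.TTheory GRing.Theory Num.Theory.
Import numFieldNormedType.Exports.

Local Open Scope classical_set_scope.
Local Open Scope ring_scope.
Local Open Scope complex_scope.

(** * Real-valued norms, limits and bounded operators *)

Section RealNorm.
Variable R : realType.

(** Norms live in [R[i]], whose order is only partial. Being nonnegative reals, they lose nothing
    when replaced by their real parts, and estimates then fall to [lra] and to real suprema. *)
Definition nrm (V : normedZmodType R[i]) (x : V) : R := complex.Re `|x|.

Lemma normE (V : normedZmodType R[i]) (x : V) : `|x| = (nrm x)%:C.
Proof.
by rewrite /nrm {1}[`|x|]complexE (ger0_Im (normr_ge0 x)) /= mulr0 addr0.
Qed.

Lemma nrm_ge0 (V : normedZmodType R[i]) (x : V) : 0 <= nrm x.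
Proof. by have := normr_ge0 x; rewrite normE ler0c. Qed.

Lemma nrm0 (V : normedZmodType R[i]) : nrm (0 : V) = 0.
Proof. by rewrite /nrm normr0. Qed.

Lemma nrm_eq0 (V : normedZmodType R[i]) (x : V) : nrm x = 0 -> x = 0.
Proof. by move=> x0; apply/eqP; rewrite -normr_eq0 normE x0. Qed.

Lemma nrm_gt0 (V : normedZmodType R[i]) (x : V) : x != 0 -> 0 < nrm x.
Proof.
move=> x0; rewrite lt_neqAle nrm_ge0 andbT; apply: contra_neq x0 => /esym.
exact: nrm_eq0.
Qed.

Lemma nrmN (V : normedZmodType R[i]) (x : V) : nrm (- x) = nrm x.
Proof. by rewrite /nrm normrN. Qed.

Lemma nrmB (V : normedZmodType R[i]) (x y : V) : nrm (x - y) = nrm (y - x).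
Proof. by rewrite /nrm distrC. Qed.

Lemma ler_nrmD (V : normedZmodType R[i]) (x y : V) :
  nrm (x + y) <= nrm x + nrm y.
Proof. by have := ler_normD x y; rewrite !normE -rmorphD lecR. Qed.

Lemma ler_nrmB (V : normedZmodType R[i]) (x y : V) :
  nrm (x - y) <= nrm x + nrm y.
Proof. by rewrite -(nrmN y) ler_nrmD. Qed.

Lemma ler_nrmBB (V : normedZmodType R[i]) (x y : V) :
  nrm x - nrm y <= nrm (x - y).
Proof. by have := ler_nrmD (x - y) y; rewrite subrK; lra. Qed.

Lemma ler_nrmBD (V : normedZmodType R[i]) (x y : V) :
  nrm x - nrm y <= nrm (x + y).
Proof. by rewrite -(nrmN y) -[y in leRHS]opprK ler_nrmBB. Qed.

Lemma nrmZ (V : normedModType R[i]) (c : R[i]) (x : V) :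
  nrm (c *: x) = nrm c * nrm x.
Proof. by apply: complexI; rewrite -normE normrZ !normE rmorphM. Qed.

Lemma nrmM (x y : R[i]) : nrm (x * y) = nrm x * nrm y.
Proof. by apply: complexI; rewrite -normE normrM !normE rmorphM. Qed.

Lemma nrm_real (r : R) : 0 <= r -> nrm r%:C = r.
Proof. by move=> r0; rewrite /nrm ger0_norm ?ler0c. Qed.

Lemma nrm_sum (V : normedZmodType R[i]) (I : Type) (r : seq I) (P : pred I)
    (F : I -> V) :
  nrm (\sum_(i <- r | P i) F i) <= \sum_(i <- r | P i) nrm (F i).
Proof.
elim/big_ind2 : _ => [|x a y b xa yb|//]; first by rewrite nrm0.
by apply: le_trans (ler_nrmD _ _) _; exact: lerD.
Qed.

Lemma ler_normC_nrm (V W : normedZmodType R[i]) (x : V) (y : W) (M : R) :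
  (`|x| <= M%:C * `|y|) = (nrm x <= M * nrm y).
Proof. by rewrite !normE -rmorphM lecR. Qed.

Lemma ler_Cnorm_nrm (V W : normedZmodType R[i]) (x : V) (y : W) (M : R) :
  (M%:C * `|x| <= `|y|) = (M * nrm x <= nrm y).
Proof. by rewrite !normE -rmorphM lecR. Qed.

Lemma cvg_nrmP (V : normedModType R[i]) (u : nat -> V) (x : V) :
  u @ \oo --> x <->
  forall eps : R, 0 < eps ->
    exists N, forall n, (N <= n)%N -> nrm (u n - x) < eps.
Proof.
split.
  move=> /cvgrPdist_lt ux eps eps0.
  have e0 : 0 < eps%:C by rewrite ltcR.
  have [N _ uN] := ux _ e0; exists N => n Nn.
  by have := uN n Nn; rewrite distrC normE ltcR.
move=> ux; apply/cvgrPdist_lt => eps eps0.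
have eps_real : (complex.Re eps)%:C = eps by apply: RRe_real; exact: gtr0_real.
have [|N uN] := ux (complex.Re eps); first by rewrite -ltcR eps_real.
exists N => // n Nn /=; rewrite distrC normE -eps_real ltcR; exact: uN.
Qed.

Lemma cauchy_nrm_cvg (V : completeNormedModType R[i]) (u : nat -> V) :
  (forall eps : R, 0 < eps ->
    exists N, forall n, (N <= n)%N -> nrm (u n - u N) < eps) ->
  exists x : V, u @ \oo --> x.
Proof.
move=> cu; have : cauchy_ex (u @ \oo).
  move=> eps eps0.
  have eps_real : (complex.Re eps)%:C = eps by apply: RRe_real; exact: gtr0_real.
  have [|N uN] := cu (complex.Re eps); first by rewrite -ltcR eps_real.
  exists (u N); exists N => // n Nn; rewrite -ball_normE /ball_ /= distrC.
  by rewrite normE -eps_real ltcR; exact: uN.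
move=> /cauchy_exP /cauchy_cvgP cvu; exists (lim (u @ \oo)); exact: cvu.
Qed.

Lemma nrm_cvg_le (V : normedModType R[i]) (u : nat -> V) (x : V) (M : R) :
  u @ \oo --> x -> (exists N, forall n, (N <= n)%N -> nrm (u n) <= M) ->
  nrm x <= M.
Proof.
move=> /cvg_nrmP ux [N uN]; apply/ler_addgt0Pr => eps eps0.
have [N' uN'] := ux _ eps0.
have := uN _ (leq_maxl N N'); have := uN' _ (leq_maxr N N').
by have := ler_nrmBB x (u (maxn N N')); rewrite nrmB; lra.
Qed.

Lemma cvg_nrm_unique (V : normedModType R[i]) (u : nat -> V) (x y : V) :
  u @ \oo --> x -> u @ \oo --> y -> x = y.
Proof. exact: cvg_unique. Qed.

Section Linear.
Variables (V W : lmodType R[i]) (a : V -> W).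
Hypothesis la : linear a.

Lemma lin0 : a 0 = 0.
Proof. by have := la (-1) 0 0; rewrite scaler0 addr0 scaleN1r addNr. Qed.

Lemma linD x y : a (x + y) = a x + a y.
Proof. by have := la 1 x y; rewrite !scale1r. Qed.

Lemma linZ c x : a (c *: x) = c *: a x.
Proof. by have := la c x 0; rewrite !addr0 lin0 addr0. Qed.

Lemma linB x y : a (x - y) = a x - a y.
Proof. by rewrite linD -scaleN1r linZ scaleN1r. Qed.

Lemma lin_sum I (r : seq I) (P : pred I) (F : I -> V) :
  a (\sum_(i <- r | P i) F i) = \sum_(i <- r | P i) a (F i).
Proof. exact: (big_morph a linD lin0). Qed.

End Linear.

Definition bounded_by (E F : normedModType R[i]) (a : E -> F) (M : R) :=
  forall x, nrm (a x) <= M * nrm x.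

Lemma bounded_operatorP (E F : normedModType R[i]) (a : E -> F) :
  bounded_operator a <-> linear a /\ exists2 M, 0 < M & bounded_by a M.
Proof.
split=> -[la [M]] aM.
  split=> //; exists (Num.max M 1); first by rewrite lt_max ltr01 orbT.
  move=> x; have := aM x; rewrite ler_normC_nrm => /le_trans; apply.
  by apply: ler_wpM2r; rewrite ?nrm_ge0// le_max lexx.
by move=> aM'; split=> //; exists M => x; rewrite ler_normC_nrm.
Qed.

Lemma nrm_le_opnorm (E F : normedModType R[i]) (a : E -> F) x :
  bounded_operator a -> nrm (a x) <= opnorm a * nrm x.
Proof.
move=> /bounded_operatorP[la [M M0 aM]].
have [->|x0] := eqVneq x 0; first by rewrite lin0// !nrm0 mulr0.
have nx := nrm_gt0 x0.
have -> : nrm (a x) = nrm (a ((nrm x)^-1%:C *: x)) * nrm x.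
  rewrite linZ// nrmZ nrm_real ?invr_ge0 ?ltW// mulrAC mulVf ?mul1r//.
  by rewrite gt_eqF.
apply: ler_wpM2r; first exact: ltW.
apply: ub_le_sup.
  exists M => _ [y /= y1 <-]; apply: le_trans (aM y) _.
  rewrite -[leRHS]mulr1; apply: ler_wpM2l; first exact: ltW.
  by move: y1; rewrite normE -[1]/((1 : R)%:C) lecR.
exists ((nrm x)^-1%:C *: x) => //=.
have nV : 0 <= (nrm x)^-1 by rewrite invr_ge0 ltW.
by rewrite normE nrmZ nrm_real// mulVf ?gt_eqF.
Qed.

Lemma opnorm_le (E F : normedModType R[i]) (a : E -> F) M :
  0 <= M -> bounded_by a M -> opnorm a <= M.
Proof.
move=> M0 aM; apply: ge_sup.
  by exists (nrm (a 0)); exists 0 => //=; rewrite normr0 ler01.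
move=> _ [y /= y1 <-]; apply: le_trans (aM y) _.
rewrite -[leRHS]mulr1; apply: ler_wpM2l => //.
by move: y1; rewrite normE -[1]/((1 : R)%:C) lecR.
Qed.

End RealNorm.

Lemma cvg_seq_ext (R : realType) (V : normedModType R[i]) (u v : nat -> V) (x : V) :
  (forall k, u k = v k) -> u @ \oo --> x -> v @ \oo --> x.
Proof. by move=> /funext ->. Qed.

Lemma cvg_lin (R : realType) (V : normedModType R[i]) (u v : nat -> V)
    (a : R[i]) (x y : V) :
  u @ \oo --> x -> v @ \oo --> y ->
  (fun k => a *: u k + v k) @ \oo --> a *: x + y.
Proof. by move=> ux vy; apply: cvgD => //; apply: cvgZ => //; exact: cvg_cst. Qed.

Lemma nrm_cvg_le2 (R : realType) (V W : normedModType R[i]) (u : nat -> V)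
    (v : nat -> W) x y (M : R) :
  0 <= M -> u @ \oo --> x -> v @ \oo --> y ->
  (forall k, nrm (u k) <= M * nrm (v k)) -> nrm x <= M * nrm y.
Proof.
move=> M0 ux /cvg_nrmP vy uv; apply/ler_addgt0Pr => eps eps0.
apply: nrm_cvg_le ux _.
(* The denominator is [M + 1] because [M] may be 0. *)
have [|N vN] := vy (eps / (M + 1)); first by rewrite divr_gt0// ltr_wpDl.
exists N => n /vN vn; apply: le_trans (uv n) _.
have : M * nrm (v n) <= M * (nrm y + eps / (M + 1)).
  by apply: ler_wpM2l => //; have := ler_nrmBB (v n) y; lra.
move=> /le_trans; apply; rewrite mulrDr lerD2l mulrCA.
rewrite -[leRHS]mulr1 ler_pM2l// ler_pdivrMr ?mul1r ?ltr_wpDl//.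
by rewrite lerDl.
Qed.

(** * Coefficient functionals of a Schauder basis *)

Section Coefficients.
Variables (R : realType) (E : normedModType R[i]) (e : nat -> E).
Hypothesis basis_e : schauder_basis e.

Lemma biorth_expansion x : expansion e x (biorth e ^~ x).
Proof.
have [c [cx _]] := basis_e x.
have := @xgetPex _ (fun=> 0) [set c | expansion e x c] (ex_intro _ c cx).
by [].
Qed.

Lemma biorth_cvg x :
  (fun k => \sum_(n < k) biorth e n x *: e n) @ \oo --> x.
Proof.
apply: (@cvg_seq_ext _ _ (series (fun n => biorth e n x *: e n))).
  by move=> k; rewrite /series /= big_mkord.
exact: biorth_expansion.
Qed.

(** The main computing tool for [biorth]: the expansion picked by [xget] is the only one, so a
    coefficient formula is proved by exhibiting a convergent expansion. *)
Lemma biorth_unique x (c : nat -> R[i]) :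
  (fun k => \sum_(n < k) c n *: e n) @ \oo --> x ->
  forall n, biorth e n x = c n.
Proof.
move=> cx n; have [c' [_ c'u]] := basis_e x.
have ec : expansion e x c.
  by apply: cvg_seq_ext cx => k; rewrite /series /= big_mkord.
have /(congr1 (fun h => h n)) := c'u _ (@biorth_expansion x).
by rewrite (c'u _ ec).
Qed.

Lemma biorth_inj x y : (forall n, biorth e n x = biorth e n y) -> x = y.
Proof.
move=> xy; apply: (cvg_nrm_unique (@biorth_cvg x)).
apply: cvg_seq_ext (@biorth_cvg y) => k.
by apply: eq_bigr => i _; rewrite xy.
Qed.

Lemma biorth_lin a x y m :
  biorth e m (a *: x + y) = a * biorth e m x + biorth e m y.
Proof.
apply: (@biorth_unique _ (fun n => a * biorth e n x + biorth e n y)).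
have h := cvg_lin (a := a) (@biorth_cvg x) (@biorth_cvg y).
apply: cvg_seq_ext h => k /=.
rewrite scaler_sumr -big_split /=.
by apply: eq_bigr => i _; rewrite scalerDl scalerA.
Qed.

Lemma biorth0 m : biorth e m 0 = 0.
Proof. by have := biorth_lin (-1) 0 0 m; rewrite scaler0 addr0 mulN1r addNr. Qed.

Lemma biorthD x y m : biorth e m (x + y) = biorth e m x + biorth e m y.
Proof. by have := biorth_lin 1 x y m; rewrite scale1r mul1r. Qed.

Lemma biorthZ a x m : biorth e m (a *: x) = a * biorth e m x.
Proof. by have := biorth_lin a x 0 m; rewrite !addr0 biorth0 addr0. Qed.

Lemma biorth_sum m I (r : seq I) (P : pred I) (F : I -> E) :
  biorth e m (\sum_(i <- r | P i) F i) = \sum_(i <- r | P i) biorth e m (F i).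
Proof. exact: (big_morph (biorth e m) (fun x y => biorthD x y m) (biorth0 m)). Qed.

Lemma cvg_sum_delta (V : normedModType R[i]) (g : nat -> V) n :
  (fun k => \sum_(i < k) (i == n :> nat)%:R *: g i) @ \oo --> g n.
Proof.
apply/cvg_nrmP => eps eps0; exists n.+1 => k nk.
rewrite (bigD1 (Ordinal nk))//= eqxx scale1r big1 ?addr0 ?subrr ?nrm0//.
by move=> i /negPf; rewrite -val_eqE /= => ->; rewrite scale0r.
Qed.

Lemma biorth_basis m n : biorth e m (e n) = (m == n)%:R.
Proof. apply: (@biorth_unique (e n) (fun i => (i == n)%:R)).
exact: cvg_sum_delta. Qed.

Lemma basis_neq0 n : e n != 0.
Proof.
apply/eqP => en0; have := biorth_basis n n.
by rewrite en0 biorth0 eqxx => /esym/eqP; rewrite oner_eq0.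
Qed.

Lemma nrm_basis_gt0 n : 0 < nrm (e n).
Proof. exact/nrm_gt0/basis_neq0. Qed.

End Coefficients.

(** * Unconditional bases and coordinate projections *)

Definition unconditional_with (R : realType) (E : normedModType R[i])
    (e : nat -> E) (lam : R) :=
  1 <= lam /\ forall k (alpha beta : nat -> R[i]),
    (forall n, (n < k)%N -> nrm (alpha n) <= nrm (beta n)) ->
    nrm (\sum_(n < k) alpha n *: e n) <= lam * nrm (\sum_(n < k) beta n *: e n).

Lemma unconditionalP (R : realType) (E : normedModType R[i]) (e : nat -> E) :
  unconditional e -> exists lam, unconditional_with e lam.
Proof.
move=> [lam lam1 elam]; exists lam; split=> // k alpha beta ab.
rewrite -ler_normC_nrm; apply: elam => n /ab.
by rewrite !normE lecR.
Qed.

Section Unconditional.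
Variables (R : realType) (E : completeNormedModType R[i]) (e : nat -> E).
Variable lam : R.
Hypotheses (basis_e : schauder_basis e) (uncond_e : unconditional_with e lam).

Let lam_ge0 : 0 <= lam.
Proof. by apply: le_trans uncond_e.1. Qed.

(** Padding [alpha] with zeros allows a comparison with every longer partial sum of [x], and these
    converge to [x]. *)
Lemma nrm_sum_le x k (alpha : nat -> R[i]) :
  (forall n, (n < k)%N -> nrm (alpha n) <= nrm (biorth e n x)) ->
  nrm (\sum_(n < k) alpha n *: e n) <= lam * nrm x.
Proof.
move=> ax; set s := \sum_(n < k) _.
have cs : (fun=> s) @ \oo --> s by exact: cvg_cst.
have cx := @biorth_cvg _ _ _ basis_e x.
apply: (@nrm_cvg_le2 _ _ _ _ (fun K => \sum_(n < k + K) biorth e n x *: e n) _ _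
    lam lam_ge0 cs).
  apply/cvg_nrmP => eps eps0; have [N xN] := (cvg_nrmP _ _).1 cx _ eps0.
  by exists N => n Nn; apply: xN; rewrite (leq_trans Nn)// leq_addl.
move=> K.
have -> : s = \sum_(n < k + K) (if (n < k)%N then alpha n else 0) *: e n.
  rewrite big_split_ord /= [X in _ + X]big1 ?addr0; last first.
    by move=> i _; rewrite ltnNge leq_addr scale0r.
  by apply: eq_bigr => i _; rewrite ltn_ord.
apply: (uncond_e.2 _ (fun n => if (n < k)%N then alpha n else 0)) => n _.
by case: ifPn => [/ax//|_]; rewrite nrm0 nrm_ge0.
Qed.

Lemma nrm_biorth_le x m : nrm (biorth e m x) * nrm (e m) <= lam * nrm x.
Proof.
pose alpha n := if n == m then biorth e m x else 0.
have := @nrm_sum_le x m.+1 alpha.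
rewrite big_ord_recr /= big1 ?add0r; last first.
  by move=> i _; rewrite /alpha ltn_eqF ?scale0r.
rewrite /alpha eqxx nrmZ; apply => n _.
by case: eqP => [->//|_]; rewrite nrm0 nrm_ge0.
Qed.

(** Operators are built from their values on the basis. Domination of finite sums makes the image
    series Cauchy because the expansion of [x] is, and the bound passes to the limit. *)
Lemma basis_operator (G : completeNormedModType R[i]) (g : nat -> G) (M : R) :
  0 <= M ->
  (forall k (alpha : nat -> R[i]), nrm (\sum_(n < k) alpha n *: g n) <=
     M * nrm (\sum_(n < k) alpha n *: e n)) ->
  exists L : E -> G, [/\ linear L, bounded_by L M &
    forall x, (fun k => \sum_(n < k) biorth e n x *: g n) @ \oo --> L x].
Proof.
move=> M0 gM.
have cv x : exists y : G, (fun k => \sum_(n < k) biorth e n x *: g n) @ \oo --> y.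
  apply: cauchy_nrm_cvg => eps eps0.
  (* The 2 pays for two partial sums close to [x]; [M + 1] is positive even if [M] is 0. *)
  have [|N xN] := (cvg_nrmP _ _).1 (@biorth_cvg _ _ _ basis_e x) (eps / (2 * (M + 1))).
    by rewrite divr_gt0// mulr_gt0// ltr_wpDl.
  exists N => n Nn.
  (* A difference of partial sums is again a sum from 0, with vanishing initial coefficients, so the
     domination hypothesis applies to it. *)
  pose alpha i := if (i < N)%N then 0 else biorth e i x.
  have split_sum (V : lmodType R[i]) (h : nat -> V) :
      \sum_(i < n) biorth e i x *: h i - \sum_(i < N) biorth e i x *: h i =
      \sum_(i < n) alpha i *: h i.
    rewrite -(subnKC Nn) !big_split_ord /= addrAC subrr add0r.
    rewrite [X in _ = X + _]big1 ?add0r.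
      by apply: eq_bigr => i _; rewrite /alpha ltnNge leq_addr.
    by move=> i _; rewrite /alpha ltn_ord scale0r.
  rewrite split_sum; apply: le_lt_trans (gM _ _) _; rewrite -split_sum.
  have /xN := Nn; have /xN := leqnn N.
  move: (\sum_(i < n) _ *: e _) (\sum_(i < N) _ *: e _) => p q qx px.
  have pq : nrm (p - q) <= eps / (M + 1).
    have -> : p - q = (p - x) - (q - x) by rewrite opprB addrA subrK.
    apply: le_trans (ler_nrmB _ _) _; move: qx px.
    rewrite invfM mulrCA; set t := eps / (M + 1); lra.
  apply: (@le_lt_trans _ _ (M * (eps / (M + 1)))); first exact: ler_wpM2l.
  have M1 : 0 < M + 1 by rewrite ltr_wpDl.
  by rewrite mulrCA -[ltRHS]mulr1 ltr_pM2l// ltr_pdivrMr// mul1r ltrDl.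
have /choice [L HL] := cv; exists L; split=> // [a x y|x].
  apply: (cvg_nrm_unique (HL _)).
  have h := cvg_lin (a := a) (@HL x) (@HL y).
  apply: cvg_seq_ext h => k /=.
  rewrite scaler_sumr -big_split /=.
  by apply: eq_bigr => i _; rewrite biorth_lin// scalerDl scalerA.
apply: nrm_cvg_le2 (@HL x) (@biorth_cvg _ _ _ basis_e x) _ => // k.
exact: gM.
Qed.

(** The coordinate projection onto [S], as a limit chosen by [xget]. The series always converges by
    [restr_cvg], so the default 0 never intervenes. *)
Definition restr (S : set nat) (x : E) : E :=
  xget 0 [set y | (fun k => \sum_(n < k) ((n : nat) \in S)%:R * biorth e n x *: e n)
                  @ \oo --> y].

Lemma restr_cvg S x :
  (fun k => \sum_(n < k) ((n : nat) \in S)%:R * biorth e n x *: e n) @ \oo -->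
  restr S x.
Proof.
rewrite /restr; apply: (xgetPex (0 : E) (P := [set y | _ --> y])).
have [k alpha|L [_ _ HL]] :=
    @basis_operator E (fun n => (n \in S)%:R *: e n) lam lam_ge0.
  under eq_bigr do rewrite scalerA mulrC.
  apply: (uncond_e.2 k (fun n => (n \in S)%:R * alpha n)) => n _; rewrite nrmM.
  case: (n \in S); first by rewrite /nrm normr1 mul1r.
  by rewrite nrm0 mul0r nrm_ge0.
exists (L x); apply: cvg_seq_ext (@HL x) => k.
by apply: eq_bigr => i _; rewrite scalerA mulrC.
Qed.

Lemma biorth_restr S x m : biorth e m (restr S x) = (m \in S)%:R * biorth e m x.
Proof.
apply: (biorth_unique basis_e (c := fun n => (n \in S)%:R * biorth e n x)).
exact: restr_cvg.
Qed.

Lemma restr_lin S : linear (restr S).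
Proof.
move=> a x y; apply: (biorth_inj basis_e) => m.
by rewrite biorth_restr !biorth_lin// !biorth_restr mulrDr mulrCA.
Qed.

Lemma restr_bounded S : bounded_by (restr S) lam.
Proof.
move=> x; have h := @restr_cvg S x.
apply: nrm_cvg_le h _; exists 0%N => k _.
apply: (nrm_sum_le (alpha := fun n => (n \in S)%:R * biorth e n x)) => n _.
rewrite nrmM; case: (n \in S); first by rewrite /nrm normr1 mul1r.
by rewrite nrm0 mul0r nrm_ge0.
Qed.

Lemma restrU A B x : A `&` B = set0 -> restr (A `|` B) x = restr A x + restr B x.
Proof.
move=> AB0; apply: (biorth_inj basis_e) => m.
rewrite biorthD// !biorth_restr -mulrDl in_setU; congr (_ * _).
have : (m \in A `&` B) = false by rewrite AB0 in_set0.
by rewrite in_setI; case: (m \in A); case: (m \in B) => //; rewrite ?addr0 ?add0r.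
Qed.

Lemma restrI A B x : restr A (restr B x) = restr (A `&` B) x.
Proof.
apply: (biorth_inj basis_e) => m.
by rewrite !biorth_restr in_setI mulrA -natrM mulnb.
Qed.

Lemma restrC A x : restr A x + restr (~` A) x = x.
Proof.
apply: (biorth_inj basis_e) => m.
rewrite biorthD// !biorth_restr -mulrDl in_setC.
by case: (m \in A); rewrite ?addr0 ?add0r mul1r.
Qed.

Lemma restr_basis S n : restr S (e n) = (n \in S)%:R *: e n.
Proof.
apply: (biorth_inj basis_e) => m; rewrite biorth_restr biorthZ// biorth_basis//.
by have [->|] := eqVneq m n; rewrite ?mulr0.
Qed.

(** Sets beyond [N] do not see the [N]-th partial sum of [x], and the remainder has norm below
    [eps / lam]; hence one [N] serves all such sets. *)
Lemma restr_tail x (eps : R) : 0 < eps ->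
  exists N, forall S : set nat, (forall n, S n -> (N <= n)%N) -> nrm (restr S x) <= eps.
Proof.
move=> eps0; have lam0 : 0 < lam by apply: lt_le_trans uncond_e.1.
have [|N xN] := (cvg_nrmP _ _).1 (@biorth_cvg _ _ _ basis_e x) (eps / lam).
  by rewrite divr_gt0.
exists N => S SN; set s := \sum_(n < N) biorth e n x *: e n.
have -> : restr S x = restr S (x - s).
  rewrite (linB (restr_lin S)) (lin_sum (restr_lin S)) big1 ?subr0// => i _.
  rewrite (linZ (restr_lin S)) restr_basis memNset ?scale0r ?scaler0//.
  by move=> /SN; rewrite leqNgt ltn_ord.
apply: le_trans (restr_bounded S _) _; rewrite mulrC -ler_pdivlMr// ltW//.
by rewrite nrmB xN.
Qed.

Lemma restr_seq (s : seq nat) (S : set nat) (x : E) :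
  uniq s -> (forall n : nat, S n -> n \in s) ->
  restr S x = \sum_(n <- s) ((n \in S)%:R * biorth e n x) *: e n.
Proof.
move=> us Ss; apply: (biorth_inj basis_e) => m.
rewrite biorth_sum// biorth_restr.
under eq_bigr do rewrite biorthZ// biorth_basis//.
have [ms|ms] := boolP (m \in s).
  rewrite (bigD1_seq m)//= eqxx mulr1 big1 ?addr0// => i im.
  by rewrite eq_sym (negPf im) mulr0.
rewrite big1_seq; last first.
  move=> i /= si.
  by have [mi|] := eqVneq m i; rewrite ?mulr0//; rewrite mi si in ms.
by rewrite memNset ?mul0r// => /Ss sm; rewrite sm in ms.
Qed.

Lemma nrm_restr_le (s : seq nat) (S : set nat) (x : E) :
  uniq s -> (forall n : nat, S n -> n \in s) ->
  nrm (restr S x) <= \sum_(n <- s) nrm (biorth e n x) * nrm (e n).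
Proof.
move=> us Ss; rewrite (restr_seq x us Ss).
apply: le_trans (nrm_sum _ _ _) _; apply: ler_sum => n _.
rewrite nrmZ nrmM; case: (n \in S); first by rewrite /nrm normr1 mul1r.
by rewrite nrm0 !mul0r mulr_ge0// nrm_ge0.
Qed.

End Unconditional.

(** * Columns of elements of the uniform Roe algebra *)

Section RoeAlgebra.
Variables (R : realType) (E : completeNormedModType R[i]) (e : nat -> E).
Variables (d : nat -> nat -> R) (lam : R).
Hypotheses (basis_e : schauder_basis e) (uncond_e : unconditional_with e lam).

Let lam_gt0 : 0 < lam.
Proof. by apply: lt_le_trans uncond_e.1. Qed.

Lemma band_roe b : band_operator d e b -> uniform_roe_algebra d e b.
Proof.
move=> bb; split; first exact: bb.1.
move=> eps eps0; exists b => //; apply: le_lt_trans eps0.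
by apply: opnorm_le => // x; rewrite /= subrr nrm0 mul0r.
Qed.

Lemma basis_operator_basis (G : completeNormedModType R[i]) (g : nat -> G)
    (L : E -> G) n :
  (forall x, (fun k => \sum_(n < k) biorth e n x *: g n) @ \oo --> L x) ->
  L (e n) = g n.
Proof.
move=> HL; have h := @HL (e n); apply: (cvg_nrm_unique h).
apply: cvg_seq_ext (@cvg_sum_delta _ _ g n) => k.
by apply: eq_bigr => i _; rewrite biorth_basis.
Qed.

Lemma bounded_restr S : bounded_operator (restr e S).
Proof.
apply/bounded_operatorP; split; first exact: (restr_lin basis_e uncond_e).
by exists lam => //; exact: restr_bounded.
Qed.

Definition rank_one (x : E) (k : nat) (y : E) : E := biorth e k y *: x.

Lemma rank_one_lin x k : linear (rank_one x k).
Proof. by move=> a y z; rewrite /rank_one biorth_lin// scalerDl -scalerA. Qed.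

Lemma rank_one_bounded x k :
  bounded_by (rank_one x k) (lam / nrm (e k) * nrm x).
Proof.
move=> y; rewrite /rank_one nrmZ mulrAC; apply: ler_wpM2r; first exact: nrm_ge0.
rewrite mulrAC ler_pdivlMr ?nrm_basis_gt0//.
exact: nrm_biorth_le.
Qed.

Lemma rank_one_bop x k : bounded_operator (rank_one x k).
Proof.
apply/bounded_operatorP; split; first exact: rank_one_lin.
exists (lam / nrm (e k) * nrm x + 1).
  by rewrite ltr_wpDl// mulr_ge0 ?nrm_ge0// divr_ge0 ?nrm_ge0 ?ltW.
move=> y; apply: le_trans (rank_one_bounded x k y) _.
by apply: ler_wpM2r; rewrite ?nrm_ge0// lerDl.
Qed.

(** Replacing [x] by a partial sum leaves a matrix with finitely many nonzero entries, hence a band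
    operator, and the error is controlled by [rank_one_bounded]. *)
Lemma rank_one_roe x k : uniform_roe_algebra d e (rank_one x k).
Proof.
split; first exact: rank_one_bop.
move=> eps eps0; have ek0 := nrm_basis_gt0 basis_e k.
have [|N xN] := (cvg_nrmP _ _).1 (@biorth_cvg _ _ _ basis_e x) (eps * nrm (e k) / lam).
  by rewrite divr_gt0// mulr_gt0.
pose s := \sum_(n < N) biorth e n x *: e n.
exists (rank_one s k).
  split; first exact: rank_one_bop.
  (* A positive width exceeding each of the finitely many [d k i]. *)
  exists (1 + \sum_(i < N) `|d k i|).
    by apply: lt_le_trans ltr01 _; rewrite lerDl sumr_ge0.
  move=> n m; rewrite /rank_one biorthZ// biorth_basis// /s biorth_sum//.
  have [<-|_] := eqVneq k n; last by rewrite mul0r.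
  have [mN|Nm] := ltnP m N.
    rewrite ltNge => /negP[]; rewrite (bigD1 (Ordinal mN))//=.
    apply: le_trans (ler_norm _) _; rewrite addrCA lerDl addr_ge0//.
    by rewrite sumr_ge0.
  move=> _; rewrite big1 ?mulr0// => i _; rewrite biorthZ// biorth_basis//.
  by rewrite gtn_eqF ?mulr0// (leq_trans (ltn_ord i)).
apply: (@le_lt_trans _ _ (lam / nrm (e k) * nrm (x - s))).
  apply: opnorm_le => [|y].
    by rewrite mulr_ge0 ?nrm_ge0// divr_ge0 ?nrm_ge0 ?ltW.
  have -> : (rank_one x k \- rank_one s k) y = rank_one (x - s) k y.
    by rewrite /rank_one /= scalerBr.
  exact: rank_one_bounded.
have := xN _ (leqnn N); rewrite nrmB -/s ltr_pdivlMr// => h.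
by rewrite mulrAC ltr_pdivrMr// mulrC.
Qed.

Definition far (s : R) (n : nat) : set nat := [set m | s < d n m].

(** A band operator within [eps / lam] of [a] has columns vanishing on [far s n] once [s] is at
    least its width, so only the error survives there; [lam] is the cost of the projection. *)
Lemma roe_column a : uniform_roe_algebra d e a -> forall eps : R, 0 < eps ->
  exists s0, forall s, s0 <= s -> forall n,
    nrm (restr e (far s n) (a (e n))) <= eps * nrm (e n).
Proof.
move=> [ba ra] eps eps0.
have [|b [bb [r r0 br]] ab] := ra (eps / lam); first by rewrite divr_gt0.
exists r => s rs n.
have rl := restr_lin basis_e uncond_e (far s n).
have -> : restr e (far s n) (a (e n)) = restr e (far s n) ((a \- b) (e n)).
  rewrite /= (linB rl) [X in _ - X](_ : _ = 0) ?subr0//.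
  apply: (biorth_inj basis_e) => m.
  rewrite (biorth_restr basis_e uncond_e) biorth0//.
  have [/set_mem nm|_] := boolP (m \in far s n); last by rewrite mul0r.
  by rewrite br ?mulr0//; exact: le_lt_trans nm.
apply: le_trans (restr_bounded basis_e uncond_e _ _) _.
have bab : bounded_operator (a \- b).
  move/bounded_operatorP: ba => [la [M M0 aM]].
  move/bounded_operatorP: bb => [lb [M' M'0 bM]].
  apply/bounded_operatorP; split.
    by move=> c x y /=; rewrite la lb scalerBr opprD addrACA.
  exists (M + M') => [|x /=]; first exact: addr_gt0.
  by apply: le_trans (ler_nrmB _ _) _; rewrite mulrDl lerD.
have := nrm_le_opnorm (e n) bab.
have : opnorm (a \- b) * nrm (e n) <= eps / lam * nrm (e n).
  by apply: ler_wpM2r; rewrite ?nrm_ge0// ltW.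
move=> h1 h2; have := le_trans h2 h1.
by rewrite mulrAC ler_pdivlMr// mulrC.
Qed.

(* Gliding hump: if the estimate failed for every s, sets with bad columns could
   be glued into a single S such that T S violates the estimate for arbitrarily
   large s. *)
Section UniformColumn.
Variable T : set nat -> E -> E.
Hypothesis T_roe : forall S, uniform_roe_algebra d e (T S).
Hypothesis T_add : forall A B x, A `&` B = set0 -> T (A `|` B) x = T A x + T B x.
Hypothesis T_tail : forall n (eps : R), 0 < eps ->
  exists N, forall S : set nat, (forall i, S i -> (N <= i)%N) ->
    nrm (T S (e n)) <= eps.

Let T0 x : T set0 x = 0.
Proof.
have := @T_add set0 set0 x (setI0 _); rewrite setU0 => h.
by apply: (addrI (T set0 x)); rewrite -h addr0.
Qed.

Let cut N (A : set nat) : A = (A `&` `I_N) `|` (A `\` `I_N).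
Proof. by rewrite setUIDK. Qed.

Let T_cut N A x : T A x = T (A `&` `I_N) x + T (A `\` `I_N) x.
Proof.
rewrite {1}(cut N A) T_add//; apply/seteqP; split=> // i [[_ iN] []] //.
Qed.

(** Below [N] uniformity in [A] is elementary: [T] splits there into the fixed elements [T [set i]],
    each with its own threshold, and the largest threshold works for all [A]. *)
Let initial_column N (eps : R) : 0 < eps ->
  exists s0, forall s, s0 <= s -> forall A n,
    nrm (restr e (far s n) (T (A `&` `I_N) (e n))) <= eps * nrm (e n).
Proof.
elim: N eps => [|N IH] eps eps0.
  exists 0 => s _ A n; rewrite II0 setI0 T0 (lin0 (restr_lin basis_e uncond_e _)).
  by rewrite nrm0 mulr_ge0 ?nrm_ge0 ?ltW.
have eps2 : 0 < eps / 2 by rewrite divr_gt0.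
have [s0 Hs0] := IH _ eps2.
have [s1 Hs1] := roe_column (T_roe [set N]) eps2.
exists (Num.max s0 s1) => s; rewrite ge_max => /andP[ss0 ss1] A n.
have -> : A `&` `I_N.+1 = (A `&` `I_N) `|` (A `&` [set N]).
  by rewrite -setIUr IIS.
rewrite T_add; last first.
  by apply/seteqP; split=> // i [[_ /= iN] [_ /= iE]]; rewrite iE ltnn in iN.
rewrite (linD (restr_lin basis_e uncond_e _)).
apply: le_trans (ler_nrmD _ _) _.
have := Hs0 _ ss0 A n.
suff : nrm (restr e (far s n) (T (A `&` [set N]) (e n))) <= eps / 2 * nrm (e n).
  by move: (nrm (e n)) (nrm (restr _ _ _)) (nrm (restr _ _ _)) => x y z; lra.
have [AN|AN] := pselect (A N).
  rewrite (_ : A `&` _ = [set N]); first exact: Hs1.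
  by apply/seteqP; split=> i [] //= ->.
rewrite (_ : A `&` _ = set0).
  rewrite T0 (lin0 (restr_lin basis_e uncond_e _)).
  by rewrite nrm0 mulr_ge0 ?nrm_ge0 ?ltW.
by apply/seteqP; split=> i // [Ai iN]; move: Ai; rewrite iN.
Qed.

Lemma uniform_column (eps : R) : 0 < eps ->
  exists s, forall S n, nrm (restr e (far s n) (T S (e n))) <= eps * nrm (e n).
Proof.
move=> eps0; apply: contrapT => /forallNP bad.
have {}bad s : exists S n, eps * nrm (e n) < nrm (restr e (far s n) (T S (e n))).
  apply: contrapT => h; apply: (bad s) => S n; rewrite leNgt; apply/negP => hn.
  by apply: h; exists S, n.
have rlin A := restr_lin basis_e uncond_e A.
have rbd A := restr_bounded basis_e uncond_e A.
(* A state is a bound [N] with a set already settled below [N]. A step outputs a column and a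
   distance such that every set agreeing with the new state violates the estimate there with
   [eps / 2]. The distance is at least [N], so it tends to infinity. *)
pose next (st st' : nat * set nat) (ns : nat * R) :=
  [/\ (st.1 < st'.1)%N, forall i, (i < st.1)%N -> st'.2 i <-> st.2 i,
      st.1%:R <= ns.2 &
      forall S : set nat, (forall i, (i < st'.1)%N -> S i <-> st'.2 i) ->
        eps / 2 * nrm (e ns.1) <
        nrm (restr e (far ns.2 ns.1) (T S (e ns.1)))].
have step st : exists o : (nat * set nat) * (nat * R), next st o.1 o.2.
  case: st => N S.
  have eps8 : 0 < eps / 8 by rewrite divr_gt0.
  have [s0 Hs0] := initial_column N eps8.
  have [A [n An]] := bad (Num.max s0 N%:R).
  set s := Num.max s0 _ in An.
  have s0s : s0 <= s by rewrite /s le_max lexx.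
  have [|N' HN'] := T_tail n (eps := eps / 8 / lam * nrm (e n)).
    by rewrite mulr_gt0 ?nrm_basis_gt0// divr_gt0.
  (* Keep the settled part below [N] and copy the bad set [A] beyond it. *)
  pose S' := (S `&` `I_N) `|` (A `\` `I_N).
  exists ((maxn N.+1 N', S'), (n, s)); split=> /=.
  - by rewrite leq_maxl.
  - move=> i iN; split; first by case=> [[]//|[]].
    by move=> Si; left.
  - by rewrite /s le_max lexx orbT.
  move=> B BS'.
  set M := maxn N.+1 N' in BS'.
  have tailM C : nrm (T (C `\` `I_M) (e n)) <= eps / 8 / lam * nrm (e n).
    apply: HN' => i [_ /=] /negP; rewrite -leqNgt; apply: leq_trans.
    exact: leq_maxr.
  have farM C : nrm (restr e (far s n) (T (C `\` `I_M) (e n))) <=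
      eps / 8 * nrm (e n).
    apply: le_trans (rbd _ _) _; have := tailM C.
    by rewrite mulrAC ler_pdivlMr// mulrC.
  (* [B] and [S'] agree below [M], and [S'] and [A] agree from [N] on. So [T B] differs from [T A]
     by two initial pieces and two tails; four errors of relative size [eps / 8] leave [eps / 2]. *)
  have TB : T B (e n) = T A (e n) - T (A `&` `I_N) (e n) + T (S `&` `I_N) (e n)
      - T (S' `\` `I_M) (e n) + T (B `\` `I_M) (e n).
    rewrite (T_cut M B).
    have -> : B `&` `I_M = S' `&` `I_M.
      by apply/seteqP; split=> i [iB iM]; split=> //; exact/BS'.
    have := T_cut M S' (e n); rewrite {1}/S' T_add; last first.
      by apply/seteqP; split=> // i [[_ iN] []].
    rewrite (T_cut N A) [_ + T (A `\` _) _ - _]addrAC subrr add0r.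
    by rewrite [T (A `\` _) _ + _]addrC => ->; rewrite addrK.
  have rTB := congr1 (restr e (far s n)) TB.
  rewrite (linD (rlin _)) (linB (rlin _)) (linD (rlin _)) (linB (rlin _)) in rTB.
  have nA := Hs0 s s0s A n; have nS := Hs0 s s0s S n.
  have nS' := farM S'; have nB := farM B.
  move: An nA nS nS' nB; rewrite rTB; move: (nrm (e n)).
  move: (restr e _ (T A _)) (restr e _ (T (A `&` _) _)) (restr e _ (T (S `&` _) _))
    (restr e _ (T (S' `\` _) _)) (restr e _ (T (B `\` _) _)) => x1 x2 x3 x4 x5 r.
  have := ler_nrmBD (x1 - x2 + x3 - x4) x5.
  have := ler_nrmBB (x1 - x2 + x3) x4; have := ler_nrmBD (x1 - x2) x3.
  by have := ler_nrmBB x1 x2; lra.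
have /choice [nx nxP] := step.
pose st k := iter k (fun o => (nx o).1) (0%N, set0).
have stS k : next (st k) (st k.+1) (nx (st k)).2 by exact: nxP.
have kN k : (k <= (st k).1)%N.
  by elim: k => // k IH; have [lt_st _ _ _] := stS k; exact: leq_ltn_trans IH lt_st.
have st_agree k l i : (k <= l)%N -> (i < (st k).1)%N ->
    (i < (st l).1)%N /\ ((st l).2 i <-> (st k).2 i).
  move=> /subnKC <-; elim: (l - k)%N => [|j IH] ik; first by rewrite addn0.
  have [ij agr] := IH ik; have [lt_st agr' _ _] := stS (k + j)%N.
  rewrite addnS; split; first exact: ltn_trans lt_st.
  by rewrite -agr; exact: agr'.
(* The states are consistent, so they glue into one set agreeing with each of them below its
   bound. *)
pose S := [set i | exists2 k, (i < (st k).1)%N & (st k).2 i].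
have S_agree k i : (i < (st k).1)%N -> S i <-> (st k).2 i.
  move=> ik; split; last by exists k.
  move=> [l il Sl]; have [/st_agree lk|/ltnW/st_agree kl] := leqP l k.
    exact/(lk _ il).2.
  exact/(kl _ ik).2.
have eps2 : 0 < eps / 2 by rewrite divr_gt0.
have [s0 Hs0] := roe_column (T_roe S) eps2.
(* At stage [k] the bad distance is at least [(st k).1], hence at least [s0], against the column
   estimate for the single element [T S]. *)
pose k := Num.bound `|s0|.
have [_ _ sk /(_ S)] := stS k.
move=> /(_ (fun i => @S_agree k.+1 i)).
rewrite ltNge Hs0//; apply: le_trans sk.
apply: le_trans (ler_norm _) _; apply: le_trans (ltW (archi_boundP (normr_ge0 _))) _.
by rewrite ler_nat kN.
Qed.

End UniformColumn.
End RoeAlgebra.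

(** * Partial translations of bounded displacement *)

Lemma fsbig_lt_ord (V : nmodType) (g : nat -> V) (A : set nat) k :
  (forall n, (k <= n)%N -> g n = 0) ->
  \sum_(n \in A) g n = \sum_(n < k) (if (n : nat) \in A then g n else 0).
Proof.
move=> gk; rewrite (fsbig_ord _ _ (fun n => if n \in A then g n else 0)).
rewrite -fsbig_mkcondr; apply/esym/fsbig_widen; first by move=> i [].
by move=> i [Ai /not_andP[|//]] /= /negP; rewrite -leqNgt => /gk.
Qed.

(** Brings symmetry of the basis into the form [basis_operator] asks for. Cutting at [k] gives
    finite support, and unconditionality discards the indices outside [A], whence the factor [mu].
    The last clause is the reverse estimate on one basis vector. *)
Lemma displacement_sum (R : realType) (F : completeNormedModType R[i])
    (f : nat -> F) (del : nat -> nat -> R) (mu rho : R) (A B : set nat) sigma :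
  unconditional_with f mu -> displacement_invariant del f ->
  0 < rho -> set_bij A B sigma -> (forall i, A i -> del i (sigma i) <= rho) ->
  exists C : R, [/\ 0 < C,
    forall k (alpha : nat -> R[i]),
      nrm (\sum_(n < k) alpha n *: (((n : nat) \in A)%:R *: f (sigma n))) <=
      C * nrm (\sum_(n < k) alpha n *: f n) &
    forall n, A n -> nrm (f n) <= C * nrm (f (sigma n))].
Proof.
move=> uf disp rho0 bAB dAB; have [C C0 HC] := disp _ _ _ _ rho0 bAB dAB.
have mu1 := uf.1; have mu0 : 0 < mu by apply: lt_le_trans mu1.
pose cut k (alpha : nat -> R[i]) n := if (n < k)%N then alpha n else 0.
have key k (alpha : nat -> R[i]) :
    nrm (\sum_(n < k) (if (n : nat) \in A then alpha n *: f n else 0)) <=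
      C * nrm (\sum_(n < k) (if (n : nat) \in A then alpha n *: f (sigma n) else 0))
    /\ nrm (\sum_(n < k) (if (n : nat) \in A then alpha n *: f (sigma n) else 0)) <=
      C * nrm (\sum_(n < k) (if (n : nat) \in A then alpha n *: f n else 0)).
  have fin : finite_set (A `&` [set n | cut k alpha n != 0]).
    apply: sub_finite_set (finite_II k) => n [_] /=; rewrite /cut.
    by case: ifP; rewrite ?eqxx.
  have cutE (g : nat -> F) : \sum_(n \in A) cut k alpha n *: g n =
      \sum_(n < k) (if (n : nat) \in A then alpha n *: g n else 0).
    rewrite (@fsbig_lt_ord _ _ _ k) => [|n kn]; last first.
      by rewrite /cut ltnNge kn scale0r.
    by apply: eq_bigr => i _; rewrite /cut ltn_ord.
  have := HC _ fin; rewrite (cutE f) (cutE (f \o sigma)) /=.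
  rewrite (ler_normC_nrm _ _ C) => -[h1 h2]; split=> //.
  by rewrite -ler_pdivrMl// -ler_Cnorm_nrm; exact: h1.
have C' : 0 < C * mu by rewrite mulr_gt0.
exists (C * mu); split=> // [k alpha|n An].
  have -> : \sum_(n < k) alpha n *: (((n : nat) \in A)%:R *: f (sigma n)) =
      \sum_(n < k) (if (n : nat) \in A then alpha n *: f (sigma n) else 0).
    by apply: eq_bigr => i _; case: ifP; rewrite ?scale1r ?scale0r ?scaler0.
  apply: le_trans (key k alpha).2 _; rewrite -mulrA; apply: ler_wpM2l.
    exact: ltW.
  have -> : \sum_(n < k) (if (n : nat) \in A then alpha n *: f n else 0) =
      \sum_(n < k) ((if (n : nat) \in A then alpha n else 0) *: f n).
    by apply: eq_bigr => i _; case: ifP; rewrite ?scale0r.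
  apply: (uf.2 k (fun n => if n \in A then alpha n else 0)) => n _.
  by case: ifP => // _; rewrite nrm0 nrm_ge0.
have := (key n.+1 (fun i => (i == n)%:R)).1.
have delta (g : nat -> F) :
    \sum_(i < n.+1) (if (i : nat) \in A then (i == n :> nat)%:R *: g i else 0) = g n.
  rewrite big_ord_recr/= mem_set// eqxx scale1r big1 ?add0r// => i _.
  by rewrite ltn_eqF// scale0r if_same.
rewrite (delta f) (delta (f \o sigma)) /= => /le_trans; apply.
apply: ler_wpM2r; first exact: nrm_ge0.
by rewrite ler_peMr// ltW.
Qed.

(** * Choice of signs *)

Section Signs.
Variable R : realType.

Lemma nrm_sqr (x : R[i]) : nrm x ^+ 2 = complex.Re x ^+ 2 + complex.Im x ^+ 2.
Proof. by apply: complexI; rewrite add_Re2_Im2 normE rmorphXn. Qed.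

Lemma parallelogram (x y : R[i]) :
  nrm (x + y) ^+ 2 + nrm (x - y) ^+ 2 = 2 * (nrm x ^+ 2 + nrm y ^+ 2).
Proof. by rewrite !nrm_sqr; case: x y => [a b] [c h] /=; ring. Qed.

(* Each sign is chosen greedily: by the parallelogram law one of the two choices
   does not increase the sum of squares by more than the new terms. *)
Lemma greedy_signs (I : Type) (s : seq I) (v : I -> nat -> R[i]) M :
  exists b : nat -> bool,
    \sum_(k <- s) nrm (\sum_(m < M) (-1) ^+ b m * v k m) ^+ 2 <=
    \sum_(k <- s) \sum_(m < M) nrm (v k m) ^+ 2.
Proof.
elim: M => [|M [b Hb]].
  exists (fun=> false); apply: ler_sum => k _.
  by rewrite !big_ord0 nrm0 expr0n.
pose a k := \sum_(m < M) (-1) ^+ b m * v k m.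
pose ext c m := if (m < M)%N then b m else c.
have extE c k : \sum_(m < M.+1) (-1) ^+ ext c m * v k m = a k + (-1) ^+ c * v k M.
  rewrite big_ord_recr /= /ext ltnn; congr (_ + _); apply: eq_bigr => i _.
  by rewrite ltn_ord.
have total : \sum_(k <- s) nrm (a k + v k M) ^+ 2 +
    \sum_(k <- s) nrm (a k - v k M) ^+ 2 =
    2 * (\sum_(k <- s) nrm (a k) ^+ 2 + \sum_(k <- s) nrm (v k M) ^+ 2).
  rewrite -!big_split /= mulr_sumr; apply: eq_bigr => k _.
  exact: parallelogram.
have rhs : \sum_(k <- s) \sum_(m < M.+1) nrm (v k m) ^+ 2 =
    \sum_(k <- s) \sum_(m < M) nrm (v k m) ^+ 2 + \sum_(k <- s) nrm (v k M) ^+ 2.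
  by rewrite -big_split; apply: eq_bigr => k _; rewrite big_ord_recr.
rewrite -/(a _) in Hb.
have {}Hb : \sum_(k <- s) nrm (a k) ^+ 2 <=
    \sum_(k <- s) \sum_(m < M) nrm (v k m) ^+ 2 by [].
have [le_plus|gt_plus] := leP (\sum_(k <- s) nrm (a k + v k M) ^+ 2)
    (\sum_(k <- s) \sum_(m < M.+1) nrm (v k m) ^+ 2).
  exists (ext false); under eq_bigr do rewrite extE expr0 mul1r.
  exact: le_plus.
exists (ext true); under eq_bigr do rewrite extE expr1 mulN1r.
by move: gt_plus; rewrite rhs; lra.
Qed.

End Signs.

(** * Matrix entries of the intertwining operators *)

(** Normalised so as to be invariant under rescaling of the basis vectors, whose norms are arbitrary
    here. *)
Definition entry (R : realType) (E F : normedModType R[i]) (e : nat -> E)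
    (f : nat -> F) (a : F -> E) (n m : nat) : R :=
  nrm (biorth e n (a (f m))) * nrm (e n) / nrm (f m).

Section Transfer.
Variables (R : realType) (E F : completeNormedModType R[i]).
Variables (e : nat -> E) (f : nat -> F) (d del : nat -> nat -> R).
Variables (lam mu Lu Lw : R) (u : E -> F) (w : F -> E).
Hypotheses (basis_e : schauder_basis e) (uncond_e : unconditional_with e lam).
Hypotheses (basis_f : schauder_basis f) (uncond_f : unconditional_with f mu).
Hypotheses (lin_u : linear u) (bnd_u : bounded_by u Lu) (Lu_gt0 : 0 < Lu).
Hypotheses (lin_w : linear w) (bnd_w : bounded_by w Lw) (Lw_gt0 : 0 < Lw).
Hypothesis wuK : forall x, w (u x) = x.
Hypothesis uwK : forall y, u (w y) = y.
Hypothesis pull : forall b, uniform_roe_algebra del f b ->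
  uniform_roe_algebra d e (w \o b \o u).
Hypothesis disp_f : displacement_invariant del f.
Hypotheses (metric_d : is_metric d) (metric_del : is_metric del).

Let lam_gt0 : 0 < lam. Proof. by apply: lt_le_trans uncond_e.1. Qed.
Let mu_gt0 : 0 < mu. Proof. by apply: lt_le_trans uncond_f.1. Qed.
Let nf m : 0 < nrm (f m). Proof. exact: nrm_basis_gt0. Qed.
Let ne m : 0 < nrm (e m). Proof. exact: nrm_basis_gt0. Qed.

(** [uniform_column] for the operators [w \o L \o restr f S \o u]: [L \o restr f S] is a band
    operator of the same width as [L], and [restr_tail] at [u (e n)] gives the tail condition. *)
Lemma uniform_pull (L : F -> F) (r eps : R) :
  0 < r -> bounded_operator L ->
  (forall n m, r < del n m -> biorth f m (L (f n)) = 0) -> 0 < eps ->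
  exists s, forall S n,
    nrm (restr e (far d s n) (w (L (restr f S (u (e n)))))) <= eps * nrm (e n).
Proof.
move=> r0 bL Lr eps0; have /bounded_operatorP[linL [K K0 LK]] := bL.
have rl S := restr_lin basis_f uncond_f S.
apply: (@uniform_column _ _ e d lam basis_e uncond_e
    (fun S => w \o (L \o restr f S) \o u)) => //.
- move=> S; apply/pull/band_roe; split.
    apply/bounded_operatorP; split; first by move=> a x y /=; rewrite rl linL.
    exists (K * mu) => [|x]; first exact: mulr_gt0.
    apply: le_trans (LK _) _; rewrite -mulrA; apply: ler_wpM2l; first exact: ltW.
    exact: restr_bounded.
  exists r => // n m rnm /=.
  by rewrite (restr_basis basis_f uncond_f) (linZ linL) biorthZ// Lr// mulr0.
- by move=> A B x AB0 /=; rewrite (restrU basis_f uncond_f)// (linD linL) (linD lin_w).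
- move=> n eps' eps'0.
  have [|N HN] := restr_tail basis_f uncond_f (u (e n)) (eps := eps' / K / Lw).
    by rewrite !divr_gt0.
  exists N => S /HN h /=; apply: le_trans (bnd_w _) _.
  rewrite mulrC -ler_pdivlMr//; apply: le_trans (LK _) _.
  by rewrite mulrC -ler_pdivlMr// mulrAC.
Qed.

(** The product of the two entries is, up to normalisation, a single matrix entry of the conjugate
    of the matrix unit taking [f z] to [f m]; the hypothesis bounds its column [n'] on [S]. *)
Lemma entry_mul_le (S : set nat) (eps : R) m z n n' : S n ->
  nrm (restr e S (biorth f z (u (e n')) *: w (f m))) <= eps * nrm (e n') ->
  entry e f w n m * entry f e u z n' <= lam * eps * (nrm (f z) / nrm (f m)).
Proof.
move=> Sn; set c := biorth f z _; move=> h.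
have := nrm_biorth_le basis_e uncond_e (restr e S (c *: w (f m))) n.
rewrite (biorth_restr basis_e uncond_e) mem_set// mul1r biorthZ// nrmM.
rewrite /entry -/c; set b := nrm (biorth e n _).
have := ler_wpM2l (ltW lam_gt0) h => {}h /le_trans/(_ h) {}h.
have -> : b * nrm (e n) / nrm (f m) * (nrm c * nrm (f z) / nrm (e n')) =
    nrm c * b * nrm (e n) / nrm (e n') * (nrm (f z) / nrm (f m)) by ring.
apply: ler_wpM2r; first by rewrite divr_ge0 ?nrm_ge0.
rewrite ler_pdivrMr ?ne//. by rewrite -[leRHS]mulrA.
Qed.

(** Otherwise infinitely many bad pairs [(m, z)] with distinct components could be chosen at growing
    distances. Then [z] goes to [m] under a partial translation, and its conjugate contradicts
    [uniform_pull]. *)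
Lemma entries_far_small (rho eta : R) : 0 < rho -> 0 < eta ->
  (forall i, exists B, forall j, del i j <= rho -> (j < B)%N) ->
  exists s, forall m z n n', del m z <= rho -> s < d n n' ->
    entry e f w n m * entry f e u z n' <= eta.
Proof.
move=> rho0 eta0 /choice [bd bdP].
have [d0 _ d_sym _] := metric_d; have [_ _ del_sym _] := metric_del.
pose bad s m z := del m z <= rho /\
  exists n n', s < d n n' /\ eta < entry e f w n m * entry f e u z n'.
have bad_le s t m z : s <= t -> bad t m z -> bad s m z.
  move=> st [mz [n [n' [dn En]]]]; split=> //; exists n, n'; split=> //.
  exact: le_lt_trans dn.
suff [s Hs] : exists s, forall m z, ~ bad s m z.
  exists s => m z n n' mz sn; rewrite leNgt; apply/negP => En.
  by apply: (Hs m z); split=> //; exists n, n'.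
apply: contrapT => /forallNP allbad.
have {}allbad s : exists m z, bad s m z.
  apply: contrapT => h; apply: (allbad s) => m z mz.
  by apply: h; exists m, z.
(* One pair involves only the conjugate of one rank one operator, so it stops being bad at some
   distance. *)
have single m z : exists s, ~ bad s m z.
  have eps0 : 0 < eta / (lam * (nrm (f z) / nrm (f m))).
    by rewrite divr_gt0// mulr_gt0// divr_gt0.
  have rk : uniform_roe_algebra del f (rank_one f (f m) z).
    exact: rank_one_roe basis_f uncond_f _ _.
  have [s Hs] := roe_column basis_e uncond_e (pull rk) eps0.
  exists s => -[mz [n [n' [dn]]]]; apply/negP; rewrite -leNgt.
  have := Hs s (lexx s) n'; rewrite /= /rank_one (linZ lin_w) => h.
  have nS : far d s n' n by rewrite /far /= d_sym.
  apply: le_trans (entry_mul_le nS h) _.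
  rewrite mulrAC mulrCA mulfV ?mulr1// gt_eqF// mulr_gt0// divr_gt0//.
have /choice [sg sgP] : forall p : nat * nat, exists s, ~ bad s p.1 p.2.
  by case=> m z; exact: single.
(* If every bad pair had a component below [N], local finiteness would put both below [N']. Only
   finitely many pairs would remain, and [s'] exceeds all their thresholds [sg]. *)
have beyond N s : exists p : nat * nat, [/\ (N <= p.1)%N, (N <= p.2)%N & bad s p.1 p.2].
  apply: contrapT => h.
  pose N' := (N + \sum_(i < N) bd i)%N.
  pose s' := `|s| + \sum_(i < N') \sum_(j < N') `|sg (i : nat, j : nat)|.
  have [m [z mz]] := allbad s'.
  have ss' : s <= s'.
    apply: le_trans (ler_norm s) _; rewrite lerDl sumr_ge0// => i _.
    by rewrite sumr_ge0.
  have bdN i : (i < N)%N -> (bd i <= N')%N.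
    move=> iN; rewrite /N' (bigD1 (Ordinal iN))//= addnCA leq_addr//.
  have near_small : (m < N')%N /\ (z < N')%N.
    have NN' : (N <= N')%N by rewrite leq_addr.
    have [Nm|mN] := leqP N m.
      have [Nz|zN] := leqP N z.
        by case: h; exists (m, z); split=> //; exact: bad_le mz.
      split; last exact: leq_trans NN'.
      by apply: leq_trans (bdN _ zN); apply: bdP; rewrite del_sym; exact: mz.1.
    split; first exact: leq_trans NN'.
    by apply: leq_trans (bdN _ mN); apply: bdP; exact: mz.1.
  have [mN zN] := near_small.
  apply: (sgP (m, z)); apply: bad_le mz.
  apply: le_trans (ler_norm _) _.
  rewrite /s' (bigD1 (Ordinal mN))//= (bigD1 (Ordinal zN))//=.
  rewrite [leRHS]addrC -!addrA lerDl !addr_ge0// ?sumr_ge0// => i _.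
  by rewrite sumr_ge0.
have /choice [pk pkP] : forall q : nat * R, exists p : nat * nat,
    [/\ (q.1 <= p.1)%N, (q.1 <= p.2)%N & bad q.2 p.1 p.2].
  by case=> N s; exact: beyond.
(* Each pair is taken beyond both components of the previous ones, so both components increase
   strictly. *)
pose st k := iteri k (fun j N => let p := pk (N, j%:R) in (maxn p.1 p.2).+1) 0%N.
pose p k := pk (st k, k%:R).
have stS k : st k.+1 = (maxn (p k).1 (p k).2).+1 by [].
have bad_p k : bad k%:R (p k).1 (p k).2 by have [] := pkP (st k, k%:R).
have st_p k : (st k <= (p k).1)%N /\ (st k <= (p k).2)%N.
  by have [] := pkP (st k, k%:R).
have p_st k : ((p k).1 < st k.+1)%N /\ ((p k).2 < st k.+1)%N.
  by rewrite stS !ltnS leq_maxl leq_maxr.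
have st_le k l : (k <= l)%N -> (st k <= st l)%N.
  move=> /subnKC <-; elim: (l - k)%N => [|j IH]; first by rewrite addn0.
  rewrite addnS; apply: leq_trans IH _; have [h1 _] := st_p (k + j)%N.
  by apply: ltnW; apply: leq_ltn_trans h1 _; exact: (p_st _).1.
have p1_lt k l : (k < l)%N -> ((p k).1 < (p l).1)%N.
  by move=> /st_le kl; apply: leq_trans (st_p l).1; exact: leq_trans (p_st k).1 kl.
have p2_lt k l : (k < l)%N -> ((p k).2 < (p l).2)%N.
  by move=> /st_le kl; apply: leq_trans (st_p l).2; exact: leq_trans (p_st k).2 kl.
have p1_inj k l : (p k).1 = (p l).1 -> k = l.
  by move=> kl; have [/p1_lt|/p1_lt|//] := ltngtP k l; rewrite kl ltnn.
have p2_inj k l : (p k).2 = (p l).2 -> k = l.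
  by move=> kl; have [/p2_lt|/p2_lt|//] := ltngtP k l; rewrite kl ltnn.
pose A := range (fun k => (p k).2); pose B := range (fun k => (p k).1).
pose sigma x := (p (xget 0%N [set k | (p k).2 = x])).1.
have sigmaE k : sigma (p k).2 = (p k).1.
  rewrite /sigma; congr (p _).1; apply: p2_inj.
  exact: (@xgetPex _ 0%N [set l | (p l).2 = (p k).2] (ex_intro _ k erefl)).
have bij_sigma : set_bij A B sigma.
  split.
  - by move=> _ [k _ <-]; rewrite sigmaE; exists k.
  - move=> x y /set_mem[k _ <-] /set_mem[l _ <-].
    by rewrite !sigmaE => /p1_inj ->.
  - by move=> _ [k _ <-]; exists (p k).2; [exists k|exact: sigmaE].
have sigma_close i : A i -> del i (sigma i) <= rho.
  by move=> [k _ <-]; rewrite sigmaE del_sym; exact: (bad_p k).1.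
have [C [C0 HC fC]] := displacement_sum uncond_f disp_f rho0 bij_sigma sigma_close.
have [L [linL LC cvL]] :=
  @basis_operator _ _ _ basis_f F (fun n => (n \in A)%:R *: f (sigma n)) _ (ltW C0) HC.
have L_basis n : L (f n) = (n \in A)%:R *: f (sigma n).
  exact: (basis_operator_basis basis_f (g := fun n => (n \in A)%:R *: f (sigma n)) n cvL).
have bL : bounded_operator L.
  by apply/bounded_operatorP; split=> //; exists C.
have Lrho n m : rho < del n m -> biorth f m (L (f n)) = 0.
  rewrite L_basis biorthZ// biorth_basis//.
  have [/set_mem An|_] := boolP (n \in A); last by rewrite mul0r.
  case: eqP => [-> /lt_le_trans/(_ (sigma_close _ An))|_ _]; rewrite ?ltxx//.
  by rewrite mulr0.
(* [C] will bound the ratio [nrm (f z) / nrm (f m)] left by [entry_mul_le]. *)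
have eps0 : 0 < eta / (lam * C) by rewrite divr_gt0// mulr_gt0.
have [s Hs] := uniform_pull rho0 bL Lrho eps0.
pose k := Num.bound `|s|.
have sk : s <= k%:R.
  by apply: le_trans (ler_norm _) _; exact: ltW (archi_boundP (normr_ge0 _)).
have [_ [n [n' [dn]]]] := bad_le _ _ _ _ sk (bad_p k).
apply/negP; rewrite -leNgt.
have Ak : A (p k).2 by exists k.
(* A singleton isolates the [k]-th pair, while [s] is independent of [k]: this is what uniformity in
   the set is for. *)
have := Hs [set (p k).2] n'.
rewrite (restr_seq basis_f uncond_f _ (s := [:: (p k).2]))//; last first.
  by move=> _ /= ->; rewrite inE.
rewrite big_seq1 mem_set// mul1r (linZ linL) (linZ lin_w) L_basis mem_set//.
rewrite scale1r sigmaE => h.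
have nS : far d s n' n by rewrite /far /= d_sym.
apply: le_trans (entry_mul_le nS h) _.
have := fC _ Ak; rewrite sigmaE -ler_pdivrMr// => fle.
apply: le_trans (ler_wpM2l _ fle) _; first by rewrite mulr_ge0 ?ltW.
rewrite mulrAC mulrCA mulfV ?mulr1// gt_eqF// mulr_gt0//.
Qed.

(** For [z = m] the product measures the [k]-th coordinate of the [m]-th term in the decomposition
    of [e n] obtained by expanding [u (e n)] along [f] and applying [w]. *)
Lemma entry_mulE k m n : entry e f w k m * entry f e u m n =
  nrm ((nrm (e k) / nrm (e n))%:C * biorth e k (biorth f m (u (e n)) *: w (f m))).
Proof.
rewrite /entry biorthZ// !nrmM nrm_real ?divr_ge0 ?nrm_ge0//.
field. by rewrite !gt_eqF ?ne ?nf.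
Qed.

(** Rotating the coefficients of [u (e n)] by unimodular scalars makes all [k]-th coordinates
    nonnegative, so their absolute sum is one coordinate of [w z], with [z] controlled by
    unconditionality. *)
Lemma entry_row_sum k n M :
  \sum_(m < M) entry e f w k m * entry f e u m n <= lam * (Lw * mu * Lu).
Proof.
pose x m := biorth f m (u (e n)) *: w (f m).
pose c m := biorth e k (x m).
(* The value 1 where [c m] vanishes only keeps the modulus equal to 1. *)
pose theta m := if c m == 0 then 1 else `|c m| / c m.
have theta1 m : nrm (theta m) = 1.
  rewrite /theta; case: eqP => [_|/eqP cm]; first by rewrite /nrm normr1.
  apply: (mulIf (x := nrm (c m))); first by rewrite gt_eqF// nrm_gt0.
  by rewrite mul1r -nrmM divfK// /nrm normr_id.
have thetaE m : theta m * c m = (nrm (c m))%:C.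
  rewrite /theta -normE; case: eqP => [->|/eqP cm]; first by rewrite mulr0 normr0.
  by rewrite divfK.
pose z := \sum_(m < M) (theta m * biorth f m (u (e n))) *: f m.
have nz : nrm z <= mu * nrm (u (e n)).
  apply: (nrm_sum_le basis_f uncond_f
    (alpha := fun m => theta m * biorth f m (u (e n)))) => m _.
  by rewrite nrmM theta1 mul1r.
have coefz : biorth e k (w z) = (\sum_(m < M) nrm (c m))%:C.
  rewrite (lin_sum lin_w) biorth_sum// rmorph_sum; apply: eq_bigr => m _ /=.
  by rewrite (linZ lin_w) -scalerA biorthZ// -thetaE.
have sum_ge0 : 0 <= \sum_(m < M) nrm (c m) by apply: sumr_ge0 => m _; exact: nrm_ge0.
have := nrm_biorth_le basis_e uncond_e (w z) k; rewrite coefz nrm_real// => h.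
have -> : \sum_(m < M) entry e f w k m * entry f e u m n =
    (\sum_(m < M) nrm (c m)) * (nrm (e k) / nrm (e n)).
  rewrite mulr_suml; apply: eq_bigr => m _; rewrite entry_mulE nrmM.
  by rewrite nrm_real ?divr_ge0 ?nrm_ge0// mulrC.
rewrite mulrA ler_pdivrMr//; apply: le_trans h _; rewrite -[leRHS]mulrA ler_pM2l//.
apply: le_trans (bnd_w _) _; rewrite -!mulrA ler_pM2l//; apply: le_trans nz _.
by rewrite ler_pM2l//; exact: bnd_u.
Qed.

(* If all products were small, a greedy choice of signs would yield a set A for
   which the idempotent P_A = w \o restr f A \o u maps e_n close to e_n / 2. *)
Lemma entries_nonvanishing :
  (forall r, exists N, forall n, exists t : seq nat,
    [/\ uniq t, (size t <= N)%N & forall k, (k \in t) = (d n k <= r)]) ->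
  exists r, exists2 delta : R, 0 < delta &
    forall n, exists m k, d n k <= r /\ delta <= entry e f w k m * entry f e u m n.
Proof.
move=> balls; set Lp := Lw * mu * Lu.
have Lp0 : 0 < Lp by rewrite !mulr_gt0.
(* The estimates end with [nrm (e n)] at most [4 * eps * (2 * Lp + 1)] times itself; this [eps]
   turns the factor into one half. *)
pose eps := (8 * (2 * Lp + 1))^-1.
have eps0 : 0 < eps by rewrite invr_gt0; lra.
have band_id n m : 1 < del n m -> biorth f m (idfun (f n)) = 0.
  have [del0 _ _ _] := metric_del; rewrite /= biorth_basis//.
  by case: eqP => [->|//]; rewrite del0 ltr10.
have bop_id : @bounded_operator R F F idfun.
  by apply/bounded_operatorP; split=> //; exists 1 => // x; rewrite mul1r.
have [r Hr] := uniform_pull ltr01 bop_id band_id eps0.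
have [N HN] := balls r.
set N1 : R := N%:R + 1; have N10 : 0 < N1 by rewrite ltr_wpDl.
(* At most [N] row sums, each contributing at most [delta * (lam * Lp)], then total at most
   [(eps / N1) ^+ 2]. *)
pose delta := (eps / N1) ^+ 2 / (N1 * (lam * Lp)).
have epsN0 : 0 < eps / N1 by rewrite divr_gt0.
have delta0 : 0 < delta by rewrite divr_gt0 ?exprn_gt0// !mulr_gt0.
exists r, delta => // n; apply: contrapT => small.
have {}small m k : d n k <= r -> entry e f w k m * entry f e u m n < delta.
  by move=> nk; rewrite ltNge; apply/negP => h; apply: small; exists m, k.
have [t [ut tN tE]] := HN n.
pose P S := w (restr f S (u (e n))).
pose x m := biorth f m (u (e n)) *: w (f m).
have [|M HM] := restr_tail basis_f uncond_f (u (e n)) (eps := eps / Lw * nrm (e n)).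
  by rewrite mulr_gt0// divr_gt0.
have PE A : A `<=` `I_M -> P A = \sum_(m < M) ((m : nat) \in A)%:R *: x m.
  move=> AM; rewrite /P (restr_seq basis_f uncond_f _ (s := index_iota 0 M)).
  - rewrite big_mkord (lin_sum lin_w); apply: eq_bigr => m _.
    by rewrite (linZ lin_w) /x scalerA.
  - exact: iota_uniq.
  - by move=> i /AM /= iM; rewrite mem_index_iota.
pose v k m := (nrm (e k) / nrm (e n))%:C * biorth e k (x m).
have [b Hb] := greedy_signs t v M.
have {}Hb : \sum_(k <- t) nrm (\sum_(m < M) (-1) ^+ b m * v k m) ^+ 2 <=
    (eps / N1) ^+ 2.
  apply: le_trans Hb _.
  apply: (@le_trans _ _ (\sum_(k <- t) delta * (lam * Lp))).
    rewrite big_seq [leRHS]big_seq; apply: ler_sum => k; rewrite tE => nk.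
    (* One factor of each square is below [delta]; the other is summed by [entry_row_sum]. *)
    apply: (@le_trans _ _ (\sum_(m < M) delta * nrm (v k m))).
      apply: ler_sum => m _; rewrite expr2 ler_wpM2r ?nrm_ge0//.
      by rewrite -entry_mulE ltW// small.
    rewrite -mulr_sumr ler_pM2l//; under eq_bigr do rewrite -entry_mulE.
    exact: entry_row_sum.
  rewrite big_const_seq count_predT iter_addr_0 -mulr_natl.
  have tN1 : (size t)%:R <= N1 by rewrite ler_wpDr// ler_nat.
  have dl : 0 <= delta * (lam * Lp) by rewrite ltW// mulr_gt0// mulr_gt0.
  apply: le_trans (ler_wpM2r dl tN1) _; rewrite mulrCA /delta divfK// gt_eqF//.
  by rewrite !mulr_gt0.
(* [A] and [B] collect the plus and the minus signs, so [D] is the signed sum: small near [n] by the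
   choice of signs, small far from [n] by [uniform_pull]. *)
pose A := [set m | (m < M)%N /\ b m = false].
pose B := [set m | (m < M)%N /\ b m = true].
have AM : A `<=` `I_M by move=> m [].
have BM : B `<=` `I_M by move=> m [].
have AB0 : A `&` B = set0.
  by apply/seteqP; split=> // m [[_ bm] [_]]; rewrite bm.
have ABM : A `|` B = `I_M.
  apply/seteqP; split=> [m [[]|[]]//|m mM].
  by case bm: (b m); [right|left].
pose D := P A - P B.
have DE : D = \sum_(m < M) (-1) ^+ b m *: x m.
  rewrite /D !PE// -sumrB; apply: eq_bigr => m _; rewrite -scalerBl; congr (_ *: _).
  have -> : ((m : nat) \in A) = ~~ b m.
    by apply/idP/idP => [/set_mem[_ ->]//|/negPf bm]; apply/mem_set; split.
  have -> : ((m : nat) \in B) = b m.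
    by apply/idP/idP => [/set_mem[_ ->]//|bm]; apply/mem_set; split.
  by case: (b m); rewrite ?expr1 ?expr0 ?sub0r ?subr0.
have rl S := restr_lin basis_e uncond_e S.
have D_near : nrm (restr e (~` far d r n) D) <= eps * nrm (e n).
  apply: le_trans (nrm_restr_le basis_e uncond_e D ut _) _.
    by move=> k /negP; rewrite -leNgt tE.
  apply: (@le_trans _ _ (\sum_(k <- t) eps / N1 * nrm (e n))).
    rewrite big_seq [leRHS]big_seq; apply: ler_sum => k kt.
    have -> : nrm (biorth e k D) * nrm (e k) =
        nrm (\sum_(m < M) (-1) ^+ b m * v k m) * nrm (e n).
      have -> : \sum_(m < M) (-1) ^+ b m * v k m =
          (nrm (e k) / nrm (e n))%:C * biorth e k D.
        rewrite DE biorth_sum// mulr_sumr; apply: eq_bigr => m _.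
        by rewrite biorthZ// mulrCA.
      rewrite nrmM nrm_real ?divr_ge0 ?nrm_ge0//.
      by rewrite mulrAC divfK ?gt_eqF// mulrC.
    apply: ler_wpM2r; first exact: nrm_ge0.
    (* A single square is at most the whole sum, so each of the at most [N] near coordinates is at
       most [eps / N1]. *)
    rewrite -ler_sqr ?nnegrE ?nrm_ge0 ?(ltW epsN0)//.
    apply: le_trans Hb; rewrite (bigD1_seq k)//= lerDl sumr_ge0// => i _.
    by rewrite exprn_ge0 ?nrm_ge0.
  rewrite big_const_seq count_predT iter_addr_0 -mulr_natl mulrA ler_pM2r//.
  rewrite mulrCA -[leRHS]mulr1 ler_pM2l// ler_pdivrMr// mul1r.
  by rewrite ler_wpDr// ler_nat.
have D_far : nrm (restr e (far d r n) D) <= 2 * eps * nrm (e n).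
  rewrite /D (linB (rl _)); apply: le_trans (ler_nrmB _ _) _.
  by apply: le_trans (lerD (Hr A n) (Hr B n)) _; rewrite -mulrA mulr_natl mulr2n.
have nD : nrm D <= 3 * eps * nrm (e n).
  rewrite -(restrC basis_e uncond_e (far d r n) D).
  by apply: le_trans (ler_nrmD _ _) _; lra.
have tail : nrm (P (~` `I_M)) <= eps * nrm (e n).
  apply: le_trans (bnd_w _) _; rewrite mulrC -ler_pdivlMr// mulrAC.
  by apply: HM => i /negP; rewrite -leqNgt.
have decomp : e n = P A + P B + P (~` `I_M).
  rewrite /P -!(linD lin_w) -(restrU basis_f uncond_f)// ABM.
  by rewrite (restrC basis_f uncond_f) wuK.
have PAA : w (restr f A (u (P A))) = P A.
  by rewrite /P uwK (restrI basis_f uncond_f) setIid.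
pose q := D - P (~` `I_M).
have qE : P A = e n - P A + q.
  rewrite decomp /q /D; move: (P A) (P B) (P (~` `I_M)) => a a' c.
  rewrite [a + a' + c - a]addrAC [a + a' - a]addrAC subrr add0r.
  by rewrite -[a - a' - c]addrA -opprD [RHS]addrC subrK.
have nq : nrm q <= 4 * eps * nrm (e n).
  by apply: le_trans (ler_nrmB _ _) _; lra.
(* The idempotent [w \o restr f A \o u] fixes [P A] and kills [e n - P A], so [P A] is the image of
   the small vector [q]. Then [e n = P A + P A - q] is too small. *)
have Pq : P A = w (restr f A (u q)).
  have : w (restr f A (u (P A))) = w (restr f A (u (e n - P A + q))) by rewrite -qE.
  rewrite PAA (linD lin_u) (linB lin_u) (linD (restr_lin basis_f uncond_f A)).
  rewrite (linB (restr_lin basis_f uncond_f A)) (linD lin_w) (linB lin_w) PAA.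
  by rewrite -/(P A) subrr add0r.
have nP : nrm (P A) <= Lp * (4 * eps * nrm (e n)).
  rewrite Pq; apply: le_trans (bnd_w _) _; rewrite /Lp -!mulrA ler_pM2l//.
  apply: le_trans (restr_bounded basis_f uncond_f _ _) _; rewrite ler_pM2l//.
  apply: le_trans (bnd_u _) _; rewrite ler_pM2l//.
  by move: nq; rewrite -!mulrA.
have : nrm (e n) <= 2 * nrm (P A) + nrm q.
  have -> : e n = P A + P A - q.
    by rewrite {2}qE [P A + (_ + _)]addrA [P A + _]addrC subrK addrK.
  by have := ler_nrmB (P A + P A) q; have := ler_nrmD (P A) (P A); lra.
have epsE : eps * (8 * (2 * Lp + 1)) = 1 by rewrite mulVf// gt_eqF//; lra.
have := ne n; have : eps * (8 * (2 * Lp + 1)) * nrm (e n) = nrm (e n).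
  by rewrite epsE mul1r.
move: nP nq; set g := nrm (e n); nra.
Qed.

End Transfer.

(** * Spatial implementation of the isomorphism *)

Lemma opnorm_ge0 (R : realType) (E F : normedModType R[i]) (a : E -> F) (x : E) :
  x != 0 -> bounded_operator a -> 0 <= opnorm a.
Proof.
move=> /nrm_gt0 x0 /nrm_le_opnorm ha.
by rewrite -(pmulr_lge0 _ x0) (le_trans _ (ha x))// nrm_ge0.
Qed.

(* y_0 spans the range of the image of the projection onto e_0, and u x is the
   value at y_0 of the image of the rank one operator e_0 |-> x; multiplicativity
   of Phi makes u intertwine a and Phi a. *)
Lemma isomorphism_spatial (R : realType) (E F : completeNormedModType R[i])
    (e : nat -> E) (f : nat -> F) (d del : nat -> nat -> R) (lam mu : R) :
  schauder_basis e -> unconditional_with e lam ->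
  schauder_basis f -> unconditional_with f mu ->
  banach_algebra_isomorphic (uniform_roe_algebra d e) (uniform_roe_algebra del f) ->
  exists (u : E -> F) (w : F -> E),
    [/\ linear u /\ (exists2 L, 0 < L & bounded_by u L),
        linear w /\ (exists2 L, 0 < L & bounded_by w L),
        cancel u w /\ cancel w u,
        forall a, uniform_roe_algebra d e a ->
          uniform_roe_algebra del f (u \o a \o w) &
        forall b, uniform_roe_algebra del f b ->
          uniform_roe_algebra d e (w \o b \o u)].
Proof.
move=> be ue bf uf [Phi [[PhiB Phi_inj Phi_surj] PhiD PhiZ PhiM [C0 PhiC0]]].
set A := uniform_roe_algebra d e in PhiB Phi_inj Phi_surj PhiD PhiZ PhiM PhiC0 *.
set B := uniform_roe_algebra del f in PhiB Phi_surj *.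
have A1 x k : A (rank_one e x k) by apply: rank_one_roe be ue _ _.
have B1 y k : B (rank_one f y k) by apply: rank_one_roe bf uf _ _.
have lam0 : 0 < lam by apply: lt_le_trans ue.1.
have mu0 : 0 < mu by apply: lt_le_trans uf.1.
have rkZ c x k : c \*: rank_one e x k = rank_one e (c *: x) k.
  by apply/funext => z; rewrite /rank_one /= !scalerA mulrC.
have rkD x y k : rank_one e x k \+ rank_one e y k = rank_one e (x + y) k.
  by apply/funext => z; rewrite /rank_one /= scalerDr.
(* The given constant has no known sign; a larger positive one works since operator norms are
   nonnegative. *)
have [C C_gt0 C0C] : exists2 C, 0 < C & forall t, 0 <= t -> C0 * t <= C * t.
  exists (`|C0| + 1) => [|t t0]; first by rewrite ltr_wpDl.
  by apply: ler_wpM2r => //; have := ler_norm C0; lra.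
have PhiC a : A a -> opnorm (Phi a) <= C * opnorm a /\ opnorm a <= C * opnorm (Phi a).
  move=> Aa; have [h1 h2] := PhiC0 _ Aa; split.
    apply: le_trans h1 _; apply: C0C.
    exact: opnorm_ge0 (basis_neq0 be 0%N) (proj1 Aa).
  apply: le_trans h2 _; apply: C0C.
  exact: opnorm_ge0 (basis_neq0 bf 0%N) (proj1 (PhiB _ Aa)).
pose p := rank_one e (e 0%N) 0%N.
have Ap : A p by exact: A1.
have pe : p (e 0%N) = e 0%N by rewrite /p /rank_one biorth_basis// scale1r.
have [y1 y1P] : exists y1, Phi p y1 != 0.
  apply: contrapT => /forallNP h.
  have Phip y : Phi p y = 0 by apply/eqP; move/negP: (h y); rewrite negbK.
  (* Zero is written as a multiple of [p] so that [PhiZ] computes its image. *)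
  have A0 : A (0 \*: p) by rewrite /p rkZ.
  have : p = 0 \*: p.
    apply: Phi_inj; rewrite ?inE//.
    by rewrite PhiZ//; apply/funext => y /=; rewrite Phip scaler0.
  move=> /(congr1 (fun g => g (e 0%N))); rewrite /= pe scale0r => /eqP.
  by rewrite (negPf (basis_neq0 be 0%N)).
pose y0 := Phi p y1.
have py0 : Phi p y0 = y0.
  have : p \o p = p.
    by apply/funext => z; rewrite /p /rank_one /= biorthZ// biorth_basis// mulr1.
  move=> /(congr1 Phi); rewrite PhiM// => /(congr1 (fun g => g y1)).
  by [].
have [k kP] : exists k, biorth f k y0 != 0.
  apply: contrapT => /forallNP h; move/eqP: y1P; apply.
  apply: (biorth_inj bf) => n; rewrite biorth0//; apply/eqP.
  by move/negP: (h n); rewrite negbK.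
pose u x := Phi (rank_one e x 0%N) y0.
have lin_u : linear u.
  move=> a x y; rewrite /u -rkD -rkZ PhiD ?PhiZ//; rewrite rkZ//.
have intertwine a x : A a -> Phi a (u x) = u (a x).
  move=> Aa; rewrite /u; have -> : rank_one e (a x) 0%N = a \o rank_one e x 0%N.
    apply/funext => z; have /bounded_operatorP[la _] := proj1 Aa.
    by rewrite /rank_one /= (linZ la).
  by rewrite (PhiM _ _ Aa (A1 x 0%N)).
have ue0 : u (e 0%N) = y0 by [].
have u_inj x : u x = 0 -> x = 0.
  move=> ux; apply: (biorth_inj be) => n; rewrite biorth0//; apply: contrapT.
  move=> /eqP c0; move/eqP: y1P; apply.
  rewrite -/y0 -ue0.
  (* If some coordinate of [x] is nonzero, a rank one operator takes [x] to [e 0]; intertwining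
     would then give [y0 = 0]. *)
  have -> : e 0%N = rank_one e ((biorth e n x)^-1 *: e 0%N) n x.
    by rewrite /rank_one scalerA mulfV// scale1r.
  rewrite -intertwine// ux.
  by have /bounded_operatorP[la _] := proj1 (PhiB _ (A1 ((biorth e n x)^-1 *: e 0%N) n));
    rewrite (lin0 la).
(* [b y] takes [y0] to [y], so its preimage under [Phi] takes [e 0] to the preimage of [y] under
   [u]. *)
pose b y := rank_one f ((biorth f k y0)^-1 *: y) k.
have by0 y : b y y0 = y by rewrite /b /rank_one scalerA mulfV// scale1r.
have /choice [av avP] : forall y, exists a, A a /\ Phi a = b y.
  by move=> y; have [a Aa ab] := Phi_surj _ (B1 ((biorth f k y0)^-1 *: y) k); exists a.
pose w y := av y (e 0%N).
have uwK : cancel w u.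
  move=> y; have [Aa ab] := avP y.
  by rewrite /w -intertwine// ab ue0 by0.
have wuK : cancel u w.
  move=> x; apply/eqP; rewrite -subr_eq0; apply/eqP; apply: u_inj.
  by rewrite (linB lin_u) uwK subrr.
have lin_w : linear w.
  move=> a x y; apply: (can_inj wuK).
  by rewrite uwK lin_u !uwK.
have PhiE a : A a -> Phi a = u \o a \o w.
  by move=> Aa; apply/funext => y /=; rewrite -intertwine// uwK.
exists u, w; split.
- split=> //; exists (C * (lam / nrm (e 0%N)) * nrm y0 + 1).
    rewrite ltr_wpDl// !mulr_ge0 ?nrm_ge0// ?invr_ge0 ?nrm_ge0// ltW//.
  move=> x; rewrite /u.
  have bP := proj1 (PhiB _ (A1 x 0%N)).
  apply: le_trans (nrm_le_opnorm y0 bP) _.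
  have h1 := (PhiC _ (A1 x 0%N)).1.
  have h2 : opnorm (rank_one e x 0%N) <= lam / nrm (e 0%N) * nrm x.
    apply: opnorm_le; last exact: rank_one_bounded.
    by rewrite !mulr_ge0 ?invr_ge0 ?nrm_ge0// ltW.
  have h3 : opnorm (Phi (rank_one e x 0%N)) <= C * (lam / nrm (e 0%N) * nrm x).
    by apply: le_trans h1 _; rewrite ler_pM2l.
  apply: le_trans (ler_wpM2r (nrm_ge0 y0) h3) _.
  have -> : C * (lam / nrm (e 0%N) * nrm x) * nrm y0 =
      C * (lam / nrm (e 0%N)) * nrm y0 * nrm x by ring.
  by rewrite mulrDl mul1r lerDl nrm_ge0.
- split=> //.
  pose K := C * (mu / nrm (f k)) * nrm (biorth f k y0)^-1 * nrm (e 0%N).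
  exists (K + 1).
    by rewrite ltr_wpDl// /K !mulr_ge0 ?invr_ge0 ?nrm_ge0// ltW.
  move=> y; have [Aa ab] := avP y.
  apply: le_trans (nrm_le_opnorm (e 0%N) (proj1 Aa)) _.
  have h1 := (PhiC _ Aa).2; rewrite ab in h1.
  have h2 : opnorm (b y) <= mu / nrm (f k) * nrm ((biorth f k y0)^-1 *: y).
    apply: opnorm_le; last exact: rank_one_bounded.
    by rewrite !mulr_ge0 ?invr_ge0 ?nrm_ge0// ltW.
  have h3 := le_trans h1 (ler_wpM2l (ltW C_gt0) h2).
  apply: le_trans (ler_wpM2r (nrm_ge0 (e 0%N)) h3) _.
  have -> : C * (mu / nrm (f k) * nrm ((biorth f k y0)^-1 *: y)) * nrm (e 0%N) =
      K * nrm y by rewrite nrmZ /K; ring.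
  by rewrite mulrDl mul1r lerDl nrm_ge0.
- by [].
- by move=> a Aa; rewrite -PhiE//; exact: PhiB.
- move=> b' Bb; have [a Aa ab] := Phi_surj _ Bb.
  suff -> : w \o b' \o u = a by [].
  by rewrite -ab PhiE//; apply/funext => x /=; rewrite !wuK.
Qed.

(** * Finite balls and the coarse equivalence *)

Lemma ulf_balls (R : realType) (d : nat -> nat -> R) : unif_locally_finite d ->
  forall r, exists N, forall n, exists t : seq nat,
    [/\ uniq t, (size t <= N)%N & forall k, (k \in t) = (d n k <= r)].
Proof.
(* Local finiteness concerns positive radii, so the ball is cut out of one of radius [|r| + 1]. *)
move=> ulf r; have r0 : 0 < `|r| + 1 by rewrite ltr_wpDl.
have [N HN] := ulf _ r0; exists N => n; have cN := HN n.
set S := [set y | _] in cN.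
have finS : finite_set S by apply: card_le_finite cN _; exact: finite_II.
exists [seq k <- finmap.enum_fset (fset_set S) | d n k <= r]; split.
- by rewrite filter_uniq// finmap.fset_uniq.
- rewrite size_filter; apply: leq_trans (count_size _ _) _.
  have /finite_setP[m Sm] := finS.
  by rewrite (card_fset_set Sm) -card_le_II -(card_le_eql Sm).
- move=> k; rewrite mem_filter; have [nk|//] := leP (d n k) r.
  rewrite in_fset_set//=; apply/mem_set; rewrite /S /=.
  by apply: le_trans nk _; have := ler_norm r; lra.
Qed.

Lemma ulf_bounded (R : realType) (d : nat -> nat -> R) : unif_locally_finite d ->
  forall r i, exists B, forall j, d i j <= r -> (j < B)%N.
Proof.
move=> ulf r i; have [N HN] := ulf_balls ulf r; have [t [_ _ tE]] := HN i.
exists (\sum_(j <- t) j.+1)%N => j ij.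
by rewrite (big_rem j) ?tE//= leq_addr.
Qed.

Lemma entry_ge0 (R : realType) (E F : normedModType R[i]) (e : nat -> E)
    (f : nat -> F) (a : F -> E) n m : 0 <= entry e f a n m.
Proof. by rewrite /entry !mulr_ge0 ?invr_ge0 ?nrm_ge0. Qed.

Lemma entry_le (R : realType) (E F : completeNormedModType R[i]) (e : nat -> E)
    (f : nat -> F) (a : F -> E) (lam L : R) n m :
  schauder_basis e -> unconditional_with e lam -> schauder_basis f ->
  bounded_by a L -> entry e f a n m <= lam * L.
Proof.
move=> be ue bf aL; rewrite /entry ler_pdivrMr ?nrm_basis_gt0//.
apply: le_trans (nrm_biorth_le be ue _ _) _; rewrite -mulrA.
by apply: ler_wpM2l; [apply: le_trans ue.1|exact: aL].
Qed.

Lemma metric_ge0 (R : realType) (d : nat -> nat -> R) x y :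
  is_metric d -> 0 <= d x y.
Proof.
move=> [d0 _ dC dD]; have := dD x y x.
by rewrite d0 (dC y x); lra.
Qed.

Theorem theorem7p15 (R : realType) (d del : nat -> nat -> R)
    (E F : completeNormedModType R[i]) (e : nat -> E) (f : nat -> F) :
  is_metric d -> is_metric del ->
  unif_locally_finite d -> unif_locally_finite del ->
  symmetric_basis d e -> symmetric_basis del f ->
  ghost_idempotents_compact d e -> ghost_idempotents_compact del f ->
  banach_algebra_isomorphic (uniform_roe_algebra d e) (uniform_roe_algebra del f) ->
  coarsely_equivalent d del.
Proof.
move=> md mdel ud udel [be une di_e] [bf unf di_f] _ _ iso.
have [lam ue] := unconditionalP une; have [mu uf] := unconditionalP unf.
have [u [w [[lin_u [Lu Lu0 bu]] [lin_w [Lw Lw0 bw]] [wuK uwK] push pull]]] :=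
  isomorphism_spatial be ue bf uf iso.
(* Each estimate is taken twice, with the roles of the two spaces exchanged. *)
have far1 rho eta (rho0 : 0 < rho) (eta0 : 0 < eta) := entries_far_small
  be ue bf uf lin_w bw Lw0 pull di_f md mdel rho0 eta0 (ulf_bounded udel rho).
have far2 rho eta (rho0 : 0 < rho) (eta0 : 0 < eta) := entries_far_small
  bf uf be ue lin_u bu Lu0 push di_e mdel md rho0 eta0 (ulf_bounded ud rho).
have [r [delta delta0 nv1]] := entries_nonvanishing
  be ue bf uf lin_u bu Lu0 lin_w bw Lw0 wuK uwK pull mdel (ulf_balls ud).
have [r' [delta' delta'0 nv2]] := entries_nonvanishing
  bf uf be ue lin_w bw Lw0 lin_u bu Lu0 uwK wuK push md (ulf_balls udel).
pose al n m := entry e f w n m; pose bt m n := entry f e u m n.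
have lam0 : 0 < lam by apply: lt_le_trans ue.1.
have mu0 : 0 < mu by apply: lt_le_trans uf.1.
have al_ge0 n m : 0 <= al n m by exact: entry_ge0.
have bt_ge0 m n : 0 <= bt m n by exact: entry_ge0.
have al_le n m : al n m <= lam * Lw by exact: entry_le be ue bf bw.
have bt_le m n : bt m n <= mu * Lu by exact: entry_le bf uf be bu.
have [K K0 [lamK muK]] : exists2 K, 0 < K & lam * Lw <= K /\ mu * Lu <= K.
  exists (lam * Lw + mu * Lu); first by rewrite addr_gt0 ?mulr_gt0.
  by rewrite lerDl lerDr !mulr_ge0 ?ltW.
pose del0 := Num.min delta delta'.
have del00 : 0 < del0 by rewrite lt_min delta0.
(* All entries are at most [K], so a product bounded below bounds both factors below. *)
have [eta0 eta00 big_factor] : exists2 eta0, 0 < eta0 &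
    forall x y, 0 <= x -> 0 <= y -> x <= K -> y <= K -> del0 <= x * y ->
    eta0 <= x /\ eta0 <= y.
  exists (del0 / K) => [|x y x0 y0 xK yK xy]; first by rewrite divr_gt0.
  rewrite !ler_pdivrMr//; split; apply: le_trans xy _.
    exact: ler_wpM2l.
  by rewrite mulrC ler_wpM2l.
(* Strictly below [eta0 ^+ 2], so that two large entries contradict [far1] and [far2]. *)
pose eta := eta0 ^+ 2 / 2.
have eta_gt0 : 0 < eta by rewrite divr_gt0 ?exprn_gt0.
have big_prod x y : eta0 <= x -> eta0 <= y -> ~ (x * y <= eta).
  move=> x0 y0; apply/negP; rewrite -ltNge.
  apply: (@lt_le_trans _ _ (eta0 * eta0)).
    by rewrite /eta expr2; have := mulr_gt0 eta00 eta00; lra.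
  by apply: ler_pM => //; exact: ltW.
(* The large entry of [u] sits at [n] itself, that of [w] only at some [k] within [r] of [n]. *)
have /choice [g gP] : forall n, exists m,
    eta0 <= bt m n /\ exists k, d n k <= r /\ eta0 <= al k m.
  move=> n; have [m [k [nk h]]] := nv1 n; exists m.
  have [|||||h1 h2] := @big_factor (al k m) (bt m n).
  - exact: al_ge0.
  - exact: bt_ge0.
  - exact: le_trans lamK.
  - exact: le_trans muK.
  - by apply: le_trans h; rewrite ge_min lexx.
  by split=> //; exists k.
have cover m : exists n, eta0 <= al n m.
  have [n [z [_ h]]] := nv2 m; exists n.
  have [|||||h1 h2] := @big_factor (bt z n) (al n m).
  - exact: bt_ge0.
  - exact: al_ge0.
  - exact: le_trans muK.
  - exact: le_trans lamK.
  - by apply: le_trans h; rewrite ge_min lexx orbT.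
  by [].
have [dd0 _ dC dD] := md; have [_ _ delC _] := mdel.
exists g; split; first split.
- move=> rho rho0; have rho'0 : 0 < rho + `|r| by rewrite ltr_wpDr.
  (* The entries of [u] at [x] and of [w] at [k] near [y] are both large, and [x] lies within
     [rho + |r|] of [k]; so [g x] and [g y] cannot be far apart. *)
  have [s Hs] := far2 _ _ rho'0 eta_gt0.
  exists (`|s| + 1); first by rewrite ltr_wpDl.
  move=> x y xy; rewrite ltNge; apply/negP => sxy.
  have [bx _] := gP x; have [_ [k [yk aky]]] := gP y.
  apply: (big_prod _ _ bx aky); apply: Hs.
    by have := dD x y k; have := ler_norm r; lra.
  by have := ler_norm s; lra.
- move=> s s0; have [s1 Hs1] := far1 _ _ s0 eta_gt0.
  (* Passing from [x] to its neighbour [k] costs [r], which leaves [k] and [y] more than [s1]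
     apart. *)
  exists (`|s1| + `|r| + 1); first by rewrite ltr_wpDl// addr_ge0.
  move=> x y xy; rewrite ltNge; apply/negP => sxy.
  have [_ [k [xk akx]]] := gP x; have [byy _] := gP y.
  apply: (big_prod _ _ akx byy); apply: Hs1 => //.
  by have := dD x k y; have := ler_norm r; have := ler_norm s1; lra.
(* Any [m] is close to [g n] when the entry of [w] at [(n, m)] is large: both large entries share
   [n], at distance 0 from itself. *)
- have [s Hs] := far2 _ _ ltr01 eta_gt0.
  exists s => _ [m _ <-]; have [n anm] := cover m.
  apply: (@le_trans _ _ (del m (g n))).
    apply: ge_inf; last by exists (g n) => //; exists n.
    by exists 0 => _ [z _ <-]; exact: metric_ge0.
  rewrite leNgt; apply/negP => sgn; have [bgn _] := gP n.
  apply: (big_prod _ _ bgn anm); apply: Hs; first by rewrite dd0.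
  by rewrite delC.
Qed.
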